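(* Let $k \ge 5$ and let $G$ be an $SC_k$ graph. Then $G$ is Hamiltonian if and only if $G$ is $2$-connected, contains no $CAGE(3, \frac{k}{2}+1)$, and contains no $3$-$C_k$ pyramid as an induced subgraph.
   Context: All graphs are finite, simple, undirected and connected. A graph $G$ is an $SC_k$ graph if either $G$ has no cycle, or every induced cycle of $G$ has length exactly $k$. A graph is Hamiltonian if it has a cycle through all its vertices. For $n,l$, the cage $CAGE(n,l)$ consists of two vertices $w,z$ and $n$ paths $(u^i_1,\ldots,u^i_{l-2})$, $1\le i\le n$, each on $l-2$ vertices, with $w$ adjacent to every $u^i_1$ and $z$ adjacent to every $u^i_{l-2}$ (i.e. $n$ internally disjoint $w$–$z$ paths each with $l$ vertices). A $3$-$C_k$ pyramid is an $SC_k$ graph with $3(k-2)+2$ vertices and $3(k-1)+1$ edges having exactly two vertices of degree $4$, these two being adjacent, and all other vertices of degree $2$. *)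

(* Defs.v *)
From mathcomp Require Import all_boot.

Set Implicit Arguments.
Unset Strict Implicit.
Unset Printing Implicit Defensive.

Record sgraph := SGraph {
  vertex :> finType;
  adj : rel vertex;
  adj_sym : symmetric adj;
  adj_irr : irreflexive adj
}.

Definition edges (G : sgraph) : {set {set G}} :=
  [set [set p.1; p.2] | p in [set p : G * G | adj p.1 p.2]].

Definition degree (G : sgraph) (x : G) : nat := #|[set y | adj x y]|.

Lemma induced_sym (G : sgraph) (S : {set G}) :
  symmetric (fun x y : {x : G | x \in S} => adj (val x) (val y)).
Proof. by move=> x y; rewrite adj_sym. Qed.

Lemma induced_irr (G : sgraph) (S : {set G}) :
  irreflexive (fun x y : {x : G | x \in S} => adj (val x) (val y)).
Proof. by move=> x; rewrite adj_irr. Qed.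

Definition induced (G : sgraph) (S : {set G}) : sgraph :=
  SGraph (@induced_sym G S) (@induced_irr G S).

Definition contains_induced (G H : sgraph) : Prop :=
  exists f : H -> G, injective f /\ forall x y, adj (f x) (f y) = adj x y.

(* The empty graph is not connected. *)
Definition connected (G : sgraph) : Prop :=
  0 < #|G| /\ forall x y : G, connect (@adj G) x y.

(* The bound on #|G| excludes K_1 and K_2 from the 2-connected graphs. *)
Definition kconnected (m : nat) (G : sgraph) : Prop :=
  m < #|G| /\ forall X : {set G}, #|X| < m -> connected (induced (~: X)).

Definition is_cycle (G : sgraph) (c : seq G) : Prop :=
  2 < size c /\ ucycle (@adj G) c.

Definition is_induced_cycle (G : sgraph) (c : seq G) : Prop :=
  is_cycle c /\
  forall x y, x \in c -> y \in c -> adj x y -> y = next c x \/ x = next c y.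

Definition hamiltonian (G : sgraph) : Prop :=
  exists c : seq G, is_cycle c /\ forall x, x \in c.

(* Connectedness is included because all graphs considered are connected. *)
Definition is_SC (k : nat) (G : sgraph) : Prop :=
  connected G /\
  ((~ exists c : seq G, is_cycle c) \/
   forall c : seq G, is_induced_cycle c -> size c = k).

(* [inl false] is w, [inl true] is z, and [inr (i, j)] is the vertex of index
   j + 1 on the path of index i + 1. Meant for l >= 3: for smaller l there are
   no path vertices, and w and z are isolated. *)
Definition cage_vertex (n l : nat) : finType :=
  (bool + 'I_n * 'I_(l - 2))%type.

Definition cage_arc (n l : nat) : rel (cage_vertex n l) := fun a b =>
  match a, b with
  | inl false, inr (_, j) => j == 0 :> nat
  | inr (_, j), inl true => j.+1 == l - 2
  | inr (i, j), inr (i', j') => (i == i') && (j.+1 == j' :> nat)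
  | _, _ => false
  end.

Definition cage_adj (n l : nat) : rel (cage_vertex n l) := fun a b =>
  cage_arc a b || cage_arc b a.

Lemma cage_sym (n l : nat) : symmetric (@cage_adj n l).
Proof. by move=> a b; rewrite /cage_adj orbC. Qed.

Lemma cage_irr (n l : nat) : irreflexive (@cage_adj n l).
Proof.
move=> a; rewrite /cage_adj orbb.
by case: a => [[]|[i j]] //=; rewrite eqxx -[j.+1]addn1 -{2}[val j]addn0 eqn_add2l.
Qed.

Definition CAGE (n l : nat) : sgraph := SGraph (@cage_sym n l) (@cage_irr n l).

Definition is_3_Ck_pyramid (k : nat) (P : sgraph) : Prop :=
  [/\ is_SC k P,
      #|P| = 3 * (k - 2) + 2,
      #|edges P| = 3 * (k - 1) + 1 &
      exists a b : P,
        [/\ adj a b, degree a = 4, degree b = 4 &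
            forall x : P, x != a -> x != b -> degree x = 2]].

(* Main.v *)
(* Everything rests on one fact: when all induced cycles of G
   have the same length k >= 5, a connected set disjoint from an induced cycle C
   has at most two neighbours on C. Indeed, an induced path outside C joining
   two vertices of C, with no other neighbours on C, closes up along both arcs
   of C, so its two ends on C are consecutive or antipodal; three vertices of C
   cannot pairwise be so when k >= 5, and the remaining configuration, a path
   from x to y whose inner vertices see a third vertex z of C, gives an induced
   cycle on which z would have to lie far from x and y, forcing x = y.

   Consequently, if three disjoint connected sets are each joined to two
   vertices x and y, they lie in distinct components of G - {x, y}. A longest
   cycle of a 2-connected graph missing a vertex has an ear and thus yields such
   sets; shortest paths through them form an induced cage if x and y are not
   adjacent, and an induced pyramid if they are. Conversely, deleting two
   vertices from a Hamiltonian graph leaves at most two components, whereas a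
   cage or a pyramid contains three such sets. *)

Require Import Defs.
From mathcomp Require Import all_boot.
From mathcomp Require Import zify.

Set Implicit Arguments.
Unset Strict Implicit.
Unset Printing Implicit Defensive.

(** * Induced paths and induced cycles *)

(** Adjacency is prescribed by positions, so that chord arguments become linear arithmetic on
    indices; the default [x0] is quantified and can be exchanged freely. *)
Definition ipath (G : sgraph) (p : seq G) : Prop :=
  uniq p /\
  forall x0 i j, i < j < size p -> adj (nth x0 p i) (nth x0 p j) = (j == i.+1).

(** The second disjunct is the closing edge between the first and the last vertex. *)
Definition icycle (G : sgraph) (c : seq G) : Prop :=
  [/\ 2 < size c, uniq c &
      forall x0 i j, i < j < size c ->
        adj (nth x0 c i) (nth x0 c j)
        = (j == i.+1) || (i == 0) && (j == (size c).-1)].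

(* lia case-splits on every boolean hypothesis, which is prohibitive in the large
   contexts below. *)
Ltac nat_lia := repeat match goal with
  | H : forall _, _ |- _ => clear H
  | H : ?P |- _ =>
    lazymatch type of P with Prop => idtac end;
    lazymatch P with
    | context [@in_mem] => idtac
    | context [leq] => fail
    | context [@eq nat] => fail
    | context [@eq_op Datatypes_nat__canonical__eqtype_Equality] => fail
    | _ => idtac
    end; clear H
  end; lia.

(** Carries the hypothesis on induced cycles, phrased with [next], over to the positional form. *)
Lemma icycle_induced (G : sgraph) (c : seq G) : icycle c -> is_induced_cycle c.
Proof.
case=> c2 Uc Hadj; split; first split=> //.
  rewrite /ucycle Uc andbT.
  case: c c2 Uc Hadj => [|x s] // c2 Uc Hadj.
  apply/(pathP x) => i; rewrite size_rcons => /= i_lt.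
  rewrite nth_rcons; case: ltngtP => [i_s|i_s|i_s]; [|nat_lia|].
    rewrite -rcons_cons nth_rcons /=; case: ltnP => [_|]; last nat_lia.
    by rewrite (Hadj x i i.+1) ?eqxx //=; nat_lia.
  rewrite -rcons_cons nth_rcons /=; case: ltnP => [_|]; last nat_lia.
  by rewrite adj_sym (Hadj x 0 i) /=; move: (c2 : 1 < size s); nat_lia.
move=> x y xc yc axy.
have lx : index x c < size c by rewrite index_mem.
have ly : index y c < size c by rewrite index_mem.
have main (u v : G) : u \in c -> v \in c -> index u c < index v c -> adj u v ->
    v = next c u \/ u = next c v.
  move=> uc vc uv.
  rewrite -{1}(nth_index u uc) -{1}(nth_index u vc) Hadj ?uv ?index_mem //.
  rewrite !next_nth uc vc; case: c c2 Uc Hadj uc vc {lx ly xc yc} uv => // a s _ _ _ uc vc uv.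
  case/orP=> [/eqP e|/andP[/eqP e0 /eqP es]].
    by left; rewrite -{1}(nth_index a vc) e.
  (* Here [next] reads past the end of [s] and falls back on the default [a], which is the
     wrap-around. *)
  by right; rewrite -{1}(nth_index a uc) e0 es [RHS]nth_default /=.
case: (ltngtP (index x c) (index y c)) => [lt|gt|e]; first exact: main.
  by case: (main y x) => //; [rewrite adj_sym|right|left].
by move: axy; rewrite -(nth_index x xc) e nth_index // adj_irr.
Qed.

Lemma ipath_adj (G : sgraph) (p : seq G) x0 i j : ipath p ->
  i < size p -> j < size p ->
  adj (nth x0 p i) (nth x0 p j) = (j == i.+1) || (i == j.+1).
Proof.
case=> _ H ip jp; case: (ltngtP i j) => [ij|ji|->]; last 1 first.
- by rewrite adj_irr; nat_lia.
- by rewrite H ?ij //; nat_lia.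
by rewrite adj_sym H ?ji //; nat_lia.
Qed.

Lemma icycle_adj (G : sgraph) (c : seq G) x0 i j : icycle c ->
  i < size c -> j < size c ->
  adj (nth x0 c i) (nth x0 c j) =
  [|| j == i.+1, i == j.+1, (i == 0) && (j == (size c).-1)
    | (j == 0) && (i == (size c).-1)].
Proof.
case=> c2 _ H ip jp; case: (ltngtP i j) => [ij|ji|->]; last 1 first.
- by rewrite adj_irr; nat_lia.
- by rewrite H ?ij //; nat_lia.
by rewrite adj_sym H ?ji //; nat_lia.
Qed.

Lemma ipath1 (G : sgraph) (x : G) : ipath [:: x].
Proof. by split=> // x0 i j /=; nat_lia. Qed.

Lemma ipath_rev (G : sgraph) (p : seq G) : ipath p -> ipath (rev p).
Proof.
move=> Hp; split; first by rewrite rev_uniq; case: Hp.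
move=> x0 i j; rewrite size_rev => ij; rewrite !nth_rev; try nat_lia.
by rewrite ipath_adj //; nat_lia.
Qed.

Lemma ipath_cons (G : sgraph) (x : G) (p : seq G) : ipath p -> x \notin p ->
  (forall x0 i, i < size p -> adj x (nth x0 p i) = (i == 0)) -> ipath (x :: p).
Proof.
move=> [Up Hp] xp H; split; first by rewrite /= xp.
move=> x0 [|i] [|j] //= ij; first by rewrite H ?eqSS.
by rewrite Hp.
Qed.

Lemma ipath_sorted (G : sgraph) (p : seq G) : ipath p -> sorted (@adj G) p.
Proof.
case: p => // x p [_ H]; apply/(sortedP x) => i ip.
by rewrite H ?eqxx // ltnSn.
Qed.

Lemma icycle_rot (G : sgraph) (c : seq G) n :
  icycle c -> n < size c -> icycle (rot n c).
Proof.
move=> Hc nc; have [c2 Uc _] := Hc.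
split; rewrite ?size_rot ?rot_uniq // => x0 i j ij.
rewrite /rot !nth_cat !size_drop !nth_drop.
do 2!case: ltnP => ?; rewrite ?nth_take; try nat_lia;
  by rewrite (icycle_adj _ Hc); nat_lia.
Qed.

Lemma ipath_take (G : sgraph) (c : seq G) m :
  icycle c -> m < size c -> ipath (take m c).
Proof.
move=> [c2 Uc Hc] mc; split; first exact: take_uniq.
move=> x0 i j; rewrite size_take mc => ij; rewrite !nth_take; try nat_lia.
by rewrite Hc; nat_lia.
Qed.

(** The cross edges join the end of [p] to the start of [q] and the end of [q] to the start of [p].
    The bound on the sizes excludes two single vertices. *)
Lemma icycle_cat (G : sgraph) (p q : seq G) : ipath p -> ipath q ->
  uniq (p ++ q) -> 0 < size p -> 0 < size q -> 2 < size p + size q ->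
  (forall x0 i j, i < size p -> j < size q -> adj (nth x0 p i) (nth x0 q j) =
     (i == (size p).-1) && (j == 0) || (i == 0) && (j == (size q).-1)) ->
  icycle (p ++ q).
Proof.
move=> Hp Hq U p0 q0 pq H; split; rewrite ?size_cat // => x0 i j ij.
rewrite !nth_cat; case: ltnP => ip; case: ltnP => jp.
- rewrite ipath_adj //; nat_lia.
- rewrite H //; nat_lia.
- nat_lia.
rewrite ipath_adj //; nat_lia.
Qed.

Definition all_icycles (k : nat) (G : sgraph) : Prop :=
  forall c : seq G, icycle c -> size c = k.

Lemma SC_icycles k G : is_SC k G -> all_icycles k G.
Proof.
case=> _ [no c /icycle_induced[cc _]|all c /icycle_induced]; last exact: all.
by case: no; exists c.
Qed.

(** The path is attached to [c_0] at its first vertex and to [c_j] at its last, hence the arc is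
    traversed backwards. The bound [j.+1 < size c] makes the arc an induced path. *)
Lemma theta_icycle (G : sgraph) (c p : seq G) j :
  icycle c -> ipath p -> 0 < size p -> {in p, forall x, x \notin c} ->
  0 < j -> j.+1 < size c ->
  (forall x0 i t, i < size p -> t <= j -> adj (nth x0 p i) (nth x0 c t) =
     (i == 0) && (t == 0) || (i == (size p).-1) && (t == j)) ->
  icycle (p ++ rev (take j.+1 c)).
Proof.
move=> Hc Hp p0 dis j0 jc H.
apply: icycle_cat; rewrite ?size_rev ?size_take ?jc //; try nat_lia.
- exact/ipath_rev/ipath_take.
- rewrite cat_uniq rev_uniq; case: Hp => -> _; case: Hc => _ Uc _.
  rewrite take_uniq // andbT /= -all_predC; apply/allP => x.
  by rewrite mem_rev /= => /mem_take xc; apply: contraL xc => /dis.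
move=> x0 i t ip tj; rewrite nth_rev size_take jc // nth_take; last nat_lia.
rewrite H //; nat_lia.
Qed.

Lemma nth_rot0 (T : Type) (x0 : T) n (s : seq T) i : n < size s -> i < size s ->
  nth x0 (rot n s) i = nth x0 s (if i + n < size s then i + n else i + n - size s).
Proof.
move=> ns i_s; rewrite /rot nth_cat size_drop nth_drop.
case: ltnP => h1; case: ltnP => h2; try nat_lia; first by congr nth; nat_lia.
by rewrite nth_take; [congr nth|]; nat_lia.
Qed.

(** For the least positive [m] with [c_m] adjacent to [v], the vertex [v] and the arc from [c_0] to
    [c_m] form an induced cycle with [m + 2] vertices, unless the arc is all of [c]. *)
Lemma nbr_gap k (G : sgraph) (c : seq G) x0 v j : all_icycles k G -> 3 < k ->
  icycle c -> v \notin c -> adj v (nth x0 c 0) -> adj v (nth x0 c j) ->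
  0 < j < size c -> k <= j.+2.
Proof.
move=> Hk k3 Hc vc v0 vj jc; have sc := Hk _ Hc.
have ex : exists j, adj v (nth x0 c j) && (0 < j < size c) by exists j; rewrite vj.
case: (ex_minnP ex) => m /andP[vm mc] mmin.
have mj : m <= j by apply: mmin; rewrite vj.
case: (ltnP m.+1 k) => [mk|]; last nat_lia.
suff /Hk : icycle ([:: v] ++ rev (take m.+1 c)).
  by rewrite size_cat size_rev size_take sc mk /=; nat_lia.
apply: theta_icycle => //; try nat_lia.
- exact: ipath1.
- by move=> x; rewrite inE => /eqP->.
move=> y0 [|i] // t _ tm /=.
rewrite (set_nth_default x0); last nat_lia.
case: (ltngtP t 0) => // [t0|->]; last by rewrite v0.
case: (ltngtP t m) => // [tm'|tm'|->]; [|nat_lia|by rewrite vm].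
by apply/negP => vt; have := mmin t; rewrite vt; nat_lia.
Qed.

(** Two neighbours at distance [d] along [c] give [k <= d + 2] and [k <= (k - d) + 2] by going round
    either way, so [k <= 4]. *)
Lemma nbr_unique k (G : sgraph) (c : seq G) v x y : all_icycles k G -> 4 < k ->
  icycle c -> v \notin c -> x \in c -> y \in c -> adj v x -> adj v y -> x = y.
Proof.
move=> Hk k4 Hc vc xc yc vx vy; apply/eqP/negPn/negP => xy.
have sc := Hk _ Hc; have [_ Uc _] := Hc.
set i := index x c; set j := index y c.
have ic : i < size c by rewrite index_mem.
have jc : j < size c by rewrite index_mem.
have ij : i != j by apply: contra xy => /eqP e; rewrite -(nth_index x xc) -/i e nth_index.
have vi : adj v (nth x c i) by rewrite nth_index.
have vj : adj v (nth x c j) by rewrite nth_index.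
wlog lij : i j ic jc ij vi vj / i < j.
  move=> W; case: (ltngtP i j) => [||e]; [exact: (W i j)| |by rewrite e eqxx in ij].
  by apply: (W j i) => //; rewrite eq_sym.
have h1 : k <= (j - i).+2.
  apply: (@nbr_gap k G (rot i c) x v (j - i)); rewrite ?mem_rot ?size_rot //; try nat_lia.
  - exact: icycle_rot.
  - by rewrite nth_rot0 ?add0n ?ic //; nat_lia.
  by rewrite nth_rot0 ?subnK ?jc //; nat_lia.
have h2 : k <= (size c - (j - i)).+2.
  apply: (@nbr_gap k G (rot j c) x v (size c - (j - i)));
    rewrite ?mem_rot ?size_rot //; try nat_lia.
  - exact: icycle_rot.
  - by rewrite nth_rot0 ?add0n ?jc //; nat_lia.
  rewrite nth_rot0 //; last nat_lia.
  case: ltnP => ?; first nat_lia.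
  by rewrite (_ : _ - size c = i) //; nat_lia.
nat_lia.
Qed.

(** * Connected vertex sets *)

(** A relation on all of [G], so that sets can grow or shrink without a change of vertex type. *)
Definition restr (G : sgraph) (A : {set G}) : rel G :=
  fun x y => [&& x \in A, y \in A & adj x y].

(** The empty set qualifies. *)
Definition conn (G : sgraph) (A : {set G}) : bool :=
  [forall x in A, forall y in A, connect (restr A) x y].

Arguments restr G A x y /.

Lemma restr_sym (G : sgraph) (A : {set G}) : symmetric (restr A).
Proof. by move=> x y /=; rewrite adj_sym andbCA. Qed.

Lemma connect_restr_sym (G : sgraph) (A : {set G}) : connect_sym (restr A).
Proof. exact/sym_connect_sym/restr_sym. Qed.

Lemma connect_restrS (G : sgraph) (A B : {set G}) x y : A \subset B ->
  connect (restr A) x y -> connect (restr B) x y.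
Proof.
move=> /subsetP AB; apply: connect_sub => u v /and3P[uA vA uv].
by apply: connect1; rewrite /= !AB.
Qed.

Lemma connP (G : sgraph) (A : {set G}) :
  reflect {in A &, forall x y, connect (restr A) x y} (conn A).
Proof.
by apply: (iffP 'forall_in_'forall_in_idP) => H x; [move=> y xA; exact: H|move=> xA y; exact: H].
Qed.

Lemma conn_from (G : sgraph) (A : {set G}) r :
  {in A, forall x, connect (restr A) r x} -> conn A.
Proof.
move=> H; apply/connP => x y xA yA; apply: connect_trans (H y yA).
by rewrite connect_restr_sym H.
Qed.

Lemma restr_path (G : sgraph) (A : {set G}) x s : x \in A ->
  path (restr A) x s = path (@adj G) x s && all [in A] s.
Proof.
elim: s x => //= y s IH x xA; rewrite xA /=; case yA: (y \in A) => /=.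
  by rewrite IH //; case: adj.
by rewrite andbF.
Qed.

Lemma conn_path (G : sgraph) (s : seq G) x :
  path (@adj G) x s -> conn [set y in x :: s].
Proof.
move=> p; apply: (@conn_from _ _ x) => y; rewrite inE => ys.
have ps : path (restr [set y in x :: s]) x s.
  rewrite restr_path ?inE ?eqxx // p; apply/allP => z zs.
  by rewrite !inE zs orbT.
exact: path_connect ps _ ys.
Qed.

Lemma conn_sorted (G : sgraph) (p : seq G) : sorted (@adj G) p -> conn [set x in p].
Proof.
case: p => [_|x p]; last exact: conn_path.
by apply/connP => x y; rewrite inE.
Qed.

Lemma conn1 (G : sgraph) (x : G) : conn [set x].
Proof. by apply: (@conn_from _ _ x) => y /set1P ->. Qed.

Lemma connU (G : sgraph) (A B : {set G}) a b : conn A -> conn B ->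
  a \in A -> b \in B -> adj a b -> conn (A :|: B).
Proof.
move=> /connP cA /connP cB aA bB ab; apply: (@conn_from _ _ a) => x.
case/setUP => [xA|xB]; first exact: connect_restrS (subsetUl _ _) (cA _ _ aA xA).
apply: connect_trans (connect_restrS (subsetUr _ _) (cB _ _ bB xB)).
by apply: connect1; rewrite /= !inE aA bB orbT.
Qed.

Lemma connI (G : sgraph) (A B : {set G}) a : conn A -> conn B ->
  a \in A -> a \in B -> conn (A :|: B).
Proof.
move=> /connP cA /connP cB aA aB; apply: (@conn_from _ _ a) => x.
case/setUP => [xA|xB]; first exact: connect_restrS (subsetUl _ _) (cA _ _ aA xA).
exact: connect_restrS (subsetUr _ _) (cB _ _ aB xB).
Qed.

Lemma conn_boundary (G : sgraph) (A S : {set G}) s t : conn A -> S \subset A ->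
  s \in S -> t \in A -> t \notin S ->
  exists u v, [/\ u \in S, v \in A, v \notin S & adj u v].
Proof.
move=> /connP cA /subsetP SA sS tA tS.
have /connectP[p] := cA _ _ (SA _ sS) tA.
elim: p s sS => [|y p IH] s sS /=; first by move=> _ e; rewrite e sS in tS.
case/andP=> /and3P[_ yA sy] py et.
have [yS|yS] := boolP (y \in S); first exact: IH py et.
by exists s, y.
Qed.

(** Reachability is reflexive, so for [x] outside [A] this is [[set x]]. *)
Definition component (G : sgraph) (A : {set G}) (x : G) : {set G} :=
  [set y | connect (restr A) x y].

Lemma component_id (G : sgraph) (A : {set G}) x : x \in component A x.
Proof. by rewrite inE. Qed.

Lemma component_closed (G : sgraph) (A : {set G}) x y z :
  y \in component A x -> y \in A -> z \in A -> adj y z -> z \in component A x.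
Proof.
rewrite !inE => xy yA zA yz; apply: connect_trans xy _.
by apply: connect1; rewrite /= yA zA.
Qed.

Lemma component_sub (G : sgraph) (A : {set G}) x : x \in A -> component A x \subset A.
Proof.
move=> xA; apply/subsetP => y; rewrite inE => /connectP[s].
rewrite restr_path // => /andP[_ /allP sA] ->.
by have := mem_last x s; rewrite inE => /predU1P[->//|/sA].
Qed.

Lemma component_conn (G : sgraph) (A : {set G}) x : x \in A -> conn (component A x).
Proof.
move=> xA; apply: (@conn_from _ _ x) => y; rewrite inE => /connectP[s ps ->].
apply/connectP; exists s => //; rewrite restr_path ?component_id //.
have:= ps; rewrite restr_path // => /andP[-> _] /=; apply/allP => z zs.
by rewrite inE; apply: path_connect ps _ _; rewrite inE zs orbT.
Qed.

Lemma conn_sub_component (G : sgraph) (A D : {set G}) x : conn D -> D \subset A ->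
  x \in D -> D \subset component A x.
Proof.
move=> /connP cD DA xD; apply/subsetP => y yD; rewrite inE.
exact: connect_restrS DA (cD _ _ xD yD).
Qed.

(** * Shortest sequences and geodesics *)

Lemma exists_notin (T : eqType) (s t : seq T) : uniq s -> size t < size s ->
  exists2 w, w \in s & w \notin t.
Proof.
move=> Us ts; apply/allPn/negP => /allP sub.
by have := uniq_leq_size Us sub; rewrite leqNgt ts.
Qed.

Lemma seq_size_min (T : finType) (P : pred (seq T)) p0 : P p0 ->
  exists2 p, P p & forall q, P q -> size p <= size q.
Proof.
(* Tuples of a given length form a finite type, so [Q] is boolean and has a least witness. *)
move=> Pp0; pose Q n := [exists t : n.-tuple T, P t].
have ex : exists n, Q n.
  by exists (size p0); apply/existsP; exists (in_tuple p0).
case: (ex_minnP ex) => m /existsP[t Pt] mmin; exists t => // q Pq.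
by rewrite size_tuple; apply: mmin; apply/existsP; exists (in_tuple q).
Qed.

Definition meets_at (T : finType) (S : {set T}) (p : seq T) n : Prop :=
  forall x0 i, i < size p -> (nth x0 p i \in S) = (i == n).

Lemma mem_take_nth (T : eqType) x0 (p : seq T) n t :
  t < n -> n <= size p -> nth x0 p t \in take n p.
Proof. by move=> tn np; rewrite -(nth_take x0 tn) mem_nth // size_takel. Qed.

Lemma size_cut (T : Type) (s : seq T) i j : i <= j <= size s ->
  size (take i s ++ drop j s) = i + (size s - j).
Proof.
case/andP=> ij js; rewrite size_cat size_drop size_takel //; exact: leq_trans js.
Qed.

(** Positions [i] to [j - 1] are dropped; the only new step goes from position [i - 1] to [j], and
    there is none when [i = 0]. *)
Lemma sorted_cut (T : Type) (e : rel T) x0 (s : seq T) i j : sorted e s ->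
  i < j -> j < size s -> (0 < i -> e (nth x0 s i.-1) (nth x0 s j)) ->
  sorted e (take i s ++ drop j s).
Proof.
move=> ss ij js eij; case: i ij eij => [|i] ij eij.
  by rewrite take0; apply: drop_sorted.
have i_s : i < size s by rewrite (ltn_trans _ js) // ltnW.
rewrite (take_nth x0) // (drop_nth x0) // cat_rcons.
have s1 := take_sorted i.+1 ss; rewrite (take_nth x0) // in s1.
have s2 := drop_sorted j ss; rewrite (drop_nth x0) // in s2.
have e1 := eij isT; rewrite /= in e1.
case: (take i s) s1 => [_|t r] /=; first by rewrite e1.
by rewrite cat_path rcons_path => /andP[-> lr] /=; rewrite lr e1.
Qed.

(** Among all paths in [A] that start in [S] and end in [T], a shortest one works: a repeated
    vertex, a chord, a later visit to [S] or an earlier visit to [T] would each allow a shorter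
    path. *)
Lemma geodesic (G : sgraph) (A S T : {set G}) u v :
  connect (restr A) u v -> u \in A -> u \in S -> v \in T ->
  exists p : seq G, [/\ ipath p, 0 < size p, {subset p <= A},
    meets_at S p 0 & meets_at T p (size p).-1].
Proof.
move=> /connectP[s ps ev] uA uS vT.
pose P (p : seq G) := [&& sorted (@adj G) p, all [in A] p, 0 < size p,
  nth u p 0 \in S & nth u p (size p).-1 \in T].
have Ps : P (u :: s).
  move: ps; rewrite restr_path // /P /= => /andP[-> ->].
  by rewrite uA uS -[size s]/(size (u :: s)).-1 nth_last /= -ev vT.
have [p /and5P[sp /allP pA p0 pS pT] pmin] := seq_size_min Ps.
(* Dropping positions [i] to [j - 1] contradicts minimality; for [i = 0] the path gets a new start,
   which must lie in [S]. *)
have cut i j : i < j -> j < size p -> (0 < i -> adj (nth u p i.-1) (nth u p j)) ->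
    (i = 0 -> nth u p j \in S) -> False.
  move=> ij jp aij jS; have ij' : i <= j <= size p by rewrite (ltnW ij) ltnW.
  suff /pmin : P (take i p ++ drop j p).
    by rewrite size_cut //; clear -ij jp; lia.
  have szi : size (take i p) = i by rewrite size_takel // ltnW // (ltn_trans ij).
  apply/and5P; split.
  - exact: (@sorted_cut _ _ u).
  - by apply/allP => x; rewrite mem_cat => /orP[/mem_take|/mem_drop]; exact: pA.
  - by rewrite size_cut //; clear -jp; lia.
  - rewrite nth_cat szi nth_drop; case: posnP => i0; last by rewrite nth_take.
    by rewrite i0 subn0 addn0 jS.
  rewrite size_cut // nth_cat szi nth_drop ifF; last by clear -jp; lia.
  by rewrite (_ : _ + _ = (size p).-1) //; clear -ij jp; lia.
have srt i : i.+1 < size p -> adj (nth u p i) (nth u p i.+1).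
  by move/(sortedP u): sp; apply.
have Up : uniq p.
  apply/negPn/negP => /(uniqPn u)[i [j [ij jp e]]].
  apply: (cut i j ij jp) => [i0|i0]; last by rewrite -e i0.
  by rewrite -e; have := srt i.-1; rewrite prednK //; apply; exact: ltn_trans jp.
exists p; split=> //.
- split=> // x0 i j /andP[ij jp]; rewrite !(set_nth_default u x0) //; last by clear -ij jp; lia.
  apply/idP/eqP => [aij|ej]; last by rewrite ej in jp *; apply: srt.
  case: (ltngtP j i.+1) => // lt; first by clear -lt ij; lia.
  by case: (cut i.+1 j).
- move=> x0 i ip; rewrite (set_nth_default u) //.
  apply/idP/eqP => [iS|->] //.
  case: (posnP i) => // i0; case: (cut 0 i) => //.
move=> x0 i ip; rewrite (set_nth_default u) //.
apply/idP/eqP => [iT|->] //.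
case: (ltngtP i (size p).-1) => // [ilt|]; last by clear -ip; lia.
have szi : size (take i.+1 p) = i.+1 by rewrite size_takel.
suff /pmin : P (take i.+1 p) by rewrite szi; clear -ilt; lia.
apply/and5P; split; rewrite ?szi //=.
- exact: take_sorted.
- by apply/allP => x /mem_take; exact: pA.
- by rewrite nth_take.
by rewrite nth_take.
Qed.

Lemma conn_geodesic (G : sgraph) (A S T : {set G}) u v : conn A ->
  u \in A -> u \in S -> v \in A -> v \in T ->
  exists p : seq G, [/\ ipath p, 0 < size p, {subset p <= A},
    meets_at S p 0 & meets_at T p (size p).-1].
Proof. move=> /connP cA uA uS vA vT; exact: geodesic (cA _ _ uA vA) uA uS vT. Qed.

(* A connected set minus a maximal proper connected subset containing v is a
   single vertex. *)
Lemma noncut (G : sgraph) (B : {set G}) v : conn B -> v \in B -> B != [set v] ->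
  exists2 u, u \in B :\ v & conn (B :\ u).
Proof.
move=> cB vB Bv.
pose P (M : {set G}) := [&& v \in M, M \proper B & conn M].
have P0 : P [set v].
  by rewrite /P set11 conn1 andbT properEneq eq_sym Bv sub1set.
case: (arg_maxnP (fun M : {set G} => #|M|) P0) => M /and3P[vM pM cM] Mmax.
have /properP[sM [t tB tM]] := pM.
have [a [u [aM uB uM au]]] := conn_boundary cB sM vM tB tM.
have cMu := connU cM (conn1 u) aM (set11 u) au.
have sMu : M :|: [set u] \subset B by rewrite subUset sM sub1set.
have eMu : M :|: [set u] = B.
  apply/eqP; rewrite eqEproper sMu; apply/negP => pMu.
  have /Mmax : P (M :|: [set u]) by rewrite /P inE vM pMu cMu.
  by rewrite setUC /= cardsU1 uM add1n ltnn.
exists u; first by rewrite !inE uB andbT; apply: contraNneq uM => ->.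
by rewrite -eMu setUC setU1K.
Qed.

(** * Attachments of a connected set to an induced cycle *)

(* The positions on a k-cycle that are consecutive or antipodal. *)
Definition near (k i j : nat) : bool :=
  let d := (i - j) + (j - i) in [|| d == 1, d == k.-1 | d.*2 == k].

(** Rotating [c] to start at [c_i] reduces this to [theta_icycle]; the arc contributes [j + 1]
    vertices and its far end is [c_(i+j)], with the index taken modulo the length. *)
Lemma theta_size k (G : sgraph) (c p : seq G) x0 i j : all_icycles k G ->
  icycle c -> ipath p -> 0 < size p -> {in p, forall x, x \notin c} ->
  i < size c -> 0 < j -> j.+1 < size c ->
  (forall t n, t < size p -> n < size c -> adj (nth x0 p t) (nth x0 c n) =
     (t == 0) && (n == i) ||
     (t == (size p).-1) && (n == (if i + j < size c then i + j else i + j - size c))) ->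
  size p + j.+1 = k.
Proof.
move=> Hk Hc Hp p0 dis ic j0 jc H.
have := Hk _ (@theta_icycle G (rot i c) p j _ _ _ _ _ _ _).
rewrite size_cat size_rev size_take size_rot jc; apply=> //.
- exact: icycle_rot.
- by move=> x; rewrite mem_rot; exact: dis.
move=> y0 t n tp nj.
rewrite !(set_nth_default x0 y0) ?size_rot //; try nat_lia.
rewrite nth_rot0 //; last nat_lia.
case: ifP => h; rewrite H //; try nat_lia; case: ifP => h'; nat_lia.
Qed.

Lemma theta_near k (G : sgraph) (c p : seq G) x0 i j : all_icycles k G ->
  icycle c -> ipath p -> 0 < size p -> {in p, forall x, x \notin c} ->
  i < size c -> j < size c -> i != j ->
  (forall t n, t < size p -> n < size c -> adj (nth x0 p t) (nth x0 c n) =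
     (t == 0) && (n == i) || (t == (size p).-1) && (n == j)) ->
  near k i j.
Proof.
move=> Hk Hc; wlog lij : p i j / i < j.
  move=> W Hp p0 dis ic jc ij H.
  case: (ltngtP i j) => [lt|gt|e]; [exact: (W p)| |by rewrite e eqxx in ij].
  rewrite /near addnC; apply: (W (rev p)); rewrite ?size_rev 1?eq_sym //.
  - exact: ipath_rev.
  - by move=> x; rewrite mem_rev; exact: dis.
  move=> t n tp nc; rewrite nth_rev // H //; nat_lia.
move=> Hp p0 dis ic jc _ H.
have sc := Hk _ Hc.
have h1 : j - i = k.-1 \/ size p + (j - i).+1 = k.
  have [lt|?] := ltnP (j - i).+1 k; last by left; nat_lia.
  right; apply: (@theta_size k G c p x0 i (j - i)) => //; try nat_lia.
  by move=> t n tp nc; rewrite subnKC ?jc ?H //; nat_lia.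
have h2 : k - (j - i) = k.-1 \/ size (rev p) + (k - (j - i)).+1 = k.
  have [lt|?] := ltnP (k - (j - i)).+1 k; last by left; nat_lia.
  right; apply: (@theta_size k G c (rev p) x0 j (k - (j - i))) => //; try nat_lia.
  - exact: ipath_rev.
  - by rewrite size_rev.
  - by move=> x; rewrite mem_rev; exact: dis.
  move=> t n; rewrite size_rev => tp nc; rewrite nth_rev // H //; try nat_lia.
  case: ifP; nat_lia.
rewrite size_rev in h2; rewrite /near; nat_lia.
Qed.

Lemma theta_near_mem k (G : sgraph) (c p : seq G) x0 x y : all_icycles k G ->
  icycle c -> ipath p -> 0 < size p -> {in p, forall x, x \notin c} ->
  x \in c -> y \in c -> x != y ->
  (forall t w, t < size p -> w \in c -> adj (nth x0 p t) w =
     (t == 0) && (w == x) || (t == (size p).-1) && (w == y)) ->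
  near k (index x c) (index y c).
Proof.
move=> Hk Hc Hp p0 dis xc yc xy H; have [_ Uc _] := Hc.
apply: (@theta_near k G c p x0) => //; rewrite ?index_mem //.
  by apply: contra xy => /eqP e; rewrite -(nth_index x0 xc) e nth_index.
move=> t n tp nc; rewrite H ?mem_nth //.
by rewrite -{1}(nth_index x0 xc) -{1}(nth_index x0 yc) !nth_uniq ?index_mem.
Qed.

(* Closing p along the arc from x to y that avoids z = c_0 gives an induced cycle
   on which z has a neighbour in p, hence z is adjacent to neither x nor y and
   must be antipodal to both. *)
Lemma no_far_ear k (G : sgraph) (c p : seq G) x0 x y z : all_icycles k G ->
  4 < k -> icycle c -> ipath p -> 0 < size p -> {in p, forall x, x \notin c} ->
  x \in c -> y \in c -> z \in c -> x != y -> x != z -> y != z -> index z c = 0 ->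
  (forall t w, t < size p -> w \in c -> w != z -> adj (nth x0 p t) w =
     (t == 0) && (w == x) || (t == (size p).-1) && (w == y)) ->
  (exists2 v, v \in p & adj v z) ->
  near k (index x c) 0 -> near k (index y c) 0 -> False.
Proof.
move=> Hk k4 Hc; wlog lij : p x y / index x c < index y c.
  move=> W Hp p0 dis xc yc zc xy xz yz iz H [v vp vz] nx ny.
  case: (ltngtP (index x c) (index y c)) => [lt|gt|e].
  - by apply: (W p x y) => //; exists v.
  - apply: (W (rev p) y x); rewrite ?size_rev //.
    + exact: ipath_rev.
    + by move=> w; rewrite mem_rev; exact: dis.
    + by rewrite eq_sym.
    + move=> t w tp wc wz; rewrite nth_rev // H //; try nat_lia.
    by exists v; rewrite ?mem_rev.
  by move/eqP: xy; apply; rewrite -(nth_index x0 xc) e nth_index.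
move=> Hp p0 dis xc yc zc xy xz yz iz H [v vp vz] nx ny.
have sc := Hk _ Hc; have [_ Uc _] := Hc.
set a := index x c in lij nx *; set b := index y c in lij ny *.
have ax : nth x0 c a = x by rewrite nth_index.
have bx : nth x0 c b = y by rewrite nth_index.
have zx : nth x0 c 0 = z by rewrite -iz nth_index.
have bc : b < size c by rewrite index_mem.
clearbody a b.
have ac : a < size c := ltn_trans lij bc.
have c0 : 0 < size c := leq_ltn_trans (leq0n a) ac.
have a0 : 0 < a by case: posnP => // a0; rewrite -ax a0 zx eqxx in xz.
(* The arc between [x] and [y] that misses position 0, that is, [z]. *)
pose q := rev (take (b - a).+1 (rot a c)).
have memq n : a <= n <= b -> nth x0 c n \in q.
  move=> nab; rewrite mem_rev -[n](@subnK a); last nat_lia.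
  have -> : nth x0 c (n - a + a) = nth x0 (take (b - a).+1 (rot a c)) (n - a).
    rewrite nth_take ?nth_rot0; try nat_lia; case: ifP => //; nat_lia.
  rewrite mem_nth // size_take size_rot; case: ifP => _; first by nat_lia.
  case/andP: nab => _ nb; exact: leq_ltn_trans (leq_subr _ _) (leq_ltn_trans nb bc).
have zq : z \notin q.
  rewrite mem_rev; apply/(nthP x0) => -[n].
  rewrite size_take size_rot => nq; have nb : n < (b - a).+1 by case: ifP nq; nat_lia.
  have nac : n + a < size c by apply: leq_ltn_trans bc; nat_lia.
  rewrite nth_take // nth_rot0 // ?nac; last exact: leq_ltn_trans (leq_addr _ _) nac.
  by rewrite -zx; apply/eqP; rewrite nth_uniq //; nat_lia.
have Hq : icycle (p ++ q).
  apply: theta_icycle; rewrite ?size_rot //; try nat_lia.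
  - by apply: icycle_rot => //; nat_lia.
  - by move=> w; rewrite mem_rot; exact: dis.
  move=> y0 t n tp nab; rewrite !(set_nth_default x0 y0) ?size_rot //; try nat_lia.
  rewrite nth_rot0; try nat_lia.
  have nac : n + a < size c by apply: leq_ltn_trans bc; nat_lia.
  rewrite nac H ?mem_nth //; last first.
    by rewrite -zx nth_uniq //; nat_lia.
  rewrite -{1}ax -bx !nth_uniq //; nat_lia.
have zpq : z \notin p ++ q.
  by rewrite mem_cat negb_or zq andbT; apply: contraL zc => /dis.
(* On the new cycle [z] has the neighbour [v] and hence no other one; [v] is not on [c], whereas
   these vertices are. *)
have key n : a <= n <= b -> ~~ adj z (nth x0 c n).
  move=> nab; apply/negP => zn; have := dis v vp.
  rewrite (@nbr_unique k G (p ++ q) z v (nth x0 c n)) ?mem_cat ?vp ?memq ?orbT //.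
    by rewrite mem_nth //; case/andP: nab => _ nb; exact: leq_ltn_trans bc.
  - by rewrite -mem_cat.
  by rewrite adj_sym.
have := key a; have := key b; rewrite -zx !(icycle_adj _ Hc) //; try nat_lia.
move: nx ny; rewrite /near; nat_lia.
Qed.

(** Shortest paths in [B] from [l1] and from [l2] to a neighbour of [z] show that [x] and [y] are
    both near [z]. A shortest path from [l1] to [l2] either sees [z], which [no_far_ear] excludes,
    or shows that [x] is near [y]; three positions cannot be pairwise near when [k >= 5]. *)
Lemma attach_private k (G : sgraph) (c : seq G) (B : {set G}) x y z l1 l2 :
  all_icycles k G -> 4 < k -> icycle c -> {in B, forall b, b \notin c} ->
  conn B -> conn (B :\ l1) -> conn (B :\ l2) -> l1 \in B -> l2 \in B -> l1 != l2 ->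
  x \in c -> y \in c -> z \in c -> x != y -> x != z -> y != z -> index z c = 0 ->
  {in B, forall b, adj b x = (b == l1)} -> {in B, forall b, adj b y = (b == l2)} ->
  (exists2 b, b \in B & adj b z) ->
  {in B & c, forall b w, adj b w -> w \in [:: x; y; z]} -> False.
Proof.
move=> Hk k4 Hc dis cB cB1 cB2 l1B l2B l12 xc yc zc xy xz yz iz Hx Hy [bz bzB bzz] Ho.
have sc := Hk _ Hc.
have Hadj b w : b \in B -> w \in c ->
    adj b w = [|| (b == l1) && (w == x), (b == l2) && (w == y) | adj b z && (w == z)].
  move=> bB wc; apply/idP/or3P => [bw|].
    have := Ho _ _ bB wc bw; rewrite !inE => /or3P[] /eqP e; rewrite e in bw *.
    - by constructor 1; rewrite -Hx ?bw ?eqxx.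
    - by constructor 2; rewrite -Hy ?bw ?eqxx.
    by constructor 3; rewrite bw eqxx.
  by case=> /andP[h /eqP->] //; rewrite ?Hx ?Hy.
have nl1 : ~~ adj l1 z.
  apply/negP => h; move/eqP: xz; apply.
  by apply: (nbr_unique Hk k4 Hc (dis _ l1B)) => //; rewrite Hx.
have nl2 : ~~ adj l2 z.
  apply/negP => h; move/eqP: yz; apply.
  by apply: (nbr_unique Hk k4 Hc (dis _ l2B)) => //; rewrite Hy.
have bz1 : bz != l1 by apply: contraNneq nl1 => <-.
have bz2 : bz != l2 by apply: contraNneq nl2 => <-.
(* Within [B :\ l'] nothing sees [w'], so a shortest path from [l] to a neighbour of [z] attaches to
   [c] only at [w] and [z]. *)
have half l l' w w' : l \in B -> l != l' -> bz != l' -> conn (B :\ l') ->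
    w \in c -> w' \in c -> w != z -> w' != w -> w' != z ->
    (forall b v, b \in B -> v \in c -> adj b v =
       [|| (b == l) && (v == w), (b == l') && (v == w') | adj b z && (v == z)]) ->
    near k (index w c) 0.
  move=> lB ll' bzl' cBl wc w'c wz w'w w'z Hadj'.
  have [||||p [Hp p0 pB pS pT]] :=
    @conn_geodesic G (B :\ l') [set l] [set b | adj b z] l bz cBl;
    rewrite ?inE ?eqxx ?lB ?bzl' ?ll' //.
  rewrite -iz; apply: (@theta_near_mem k G c p x) => //.
    by move=> v /pB; rewrite !inE => /andP[_ /dis].
  move=> t v tp vc; have := pB _ (mem_nth x tp); rewrite !inE => /andP[ptl ptB].
  rewrite Hadj' // (negPf ptl) /=.
  by have := pS x t tp; have := pT x t tp; rewrite !inE => -> ->.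
have nx : near k (index x c) 0.
  by apply: (half l1 l2 x y) => //; rewrite eq_sym.
have ny : near k (index y c) 0.
  apply: (half l2 l1 y x) => //; first by rewrite eq_sym.
  by move=> b v bB vc; rewrite Hadj // orbCA.
have [||||p [Hp p0 pB pS pT]] :=
  @conn_geodesic G B [set l1] [set l2] l1 l2 cB; rewrite ?inE ?eqxx //.
have pd : {in p, forall v, v \notin c} by move=> v /pB /dis.
have Hp' t v : t < size p -> v \in c -> adj (nth x p t) v =
    [|| (t == 0) && (v == x), (t == (size p).-1) && (v == y) |
        adj (nth x p t) z && (v == z)].
  move=> tp vc; rewrite Hadj ?pB ?mem_nth //.
  by have := pS x t tp; have := pT x t tp; rewrite !inE => -> ->.
have [/hasP ez|/hasPn nz] := boolP (has (fun v => adj v z) p).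
  apply: (@no_far_ear k G c p x x y z) => //.
  by move=> t w tp wc wz; rewrite Hp' // (negPf wz) andbF orbF.
have nxy : near k (index x c) (index y c).
  apply: (@theta_near_mem k G c p x) => //.
  move=> t w tp wc; rewrite Hp' // (negPf (nz _ _)) ?mem_nth //= ?orbF //.
have ne (u v : G) : u \in c -> v \in c -> u != v -> index u c != index v c.
  move=> uc vc; apply: contra => /eqP e.
  by rewrite -(nth_index x uc) e nth_index.
have := ne _ _ xc yc xy; have := ne _ _ xc zc xz; have := ne _ _ yc zc yz.
rewrite iz; move: nxy nx ny; rewrite /near.
have : index x c < size c by rewrite index_mem.
have : index y c < size c by rewrite index_mem.
nat_lia.
Qed.

(* A smaller connected set has at most two neighbours on c, so each of two
   non-cut vertices of B carries a neighbour on c seen from no other vertex. *)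
Lemma attach_le2 k (G : sgraph) (c : seq G) (B : {set G}) x y z :
  all_icycles k G -> 4 < k -> icycle c -> {in B, forall b, b \notin c} ->
  conn B -> uniq [:: x; y; z] -> {subset [:: x; y; z] <= c} ->
  (forall w, w \in [:: x; y; z] -> exists2 b, b \in B & adj b w) -> False.
Proof.
move=> Hk k4 Hc; elim: {B}#|B| {-2}B (leqnn #|B|) x y z => [|n IH] B Bn x y z dis cB U sub att.
  have [b] := att x (mem_head _ _).
  by move: Bn; rewrite leqn0 cards_eq0 => /eqP->; rewrite inE.
have uniq_nbr b v w : b \in B -> v \in c -> w \in c -> adj b v -> adj b w -> v = w.
  by move=> bB; exact: (nbr_unique Hk k4 Hc (dis _ bB)).
(* A single vertex has at most one neighbour on [c], whereas [B] sees three vertices there. *)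
have Bne v : v \in B -> B != [set v].
  move=> vB; apply/eqP => e.
  have [b bB bx] : exists2 b, b \in B & adj b x by apply: att; rewrite !inE eqxx.
  have [b' bB' bz] : exists2 b, b \in B & adj b y by apply: att; rewrite !inE eqxx orbT.
  move: U; rewrite /= !inE (uniq_nbr b x y) ?eqxx //.
  - by apply: sub; rewrite !inE eqxx.
  - by apply: sub; rewrite !inE eqxx orbT.
  by move: bB bB'; rewrite e !inE => /eqP-> /eqP<-.
(* By induction [B :\ l] cannot see all of [s], so some vertex of [s] is seen from no vertex of [B]
   other than [l]. *)
have smaller l (s : seq G) : l \in B -> conn (B :\ l) -> size s = 3 -> uniq s ->
    {subset s <= c} -> exists2 w, w \in s & {in B, forall b, adj b w -> b = l}.
  move=> lB cl; case: s => [|s1 [|s2 [|s3 []]]] // _ Us subs.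
  pose ok w := [forall b in B, adj b w ==> (b == l)].
  have okP w : ok w -> {in B, forall b, adj b w -> b = l}.
    by move=> /forall_inP h b bB bw; apply/eqP/(implyP (h b bB)).
  case: (boolP (has ok [:: s1; s2; s3])) => [/hasP[w ws /okP h]|/hasPn no].
    by exists w.
  exfalso; apply: (IH (B :\ l) _ s1 s2 s3) => //.
  - by move: Bn; rewrite (cardsD1 l B) lB.
  - by move=> b; rewrite !inE => /andP[_ /dis].
  move=> w /no; rewrite negb_forall_in => /exists_inP[b bB].
  by rewrite negb_imply => /andP[bw bl]; exists b; rewrite // !inE bl.
have [b0 b0B _] : exists2 b, b \in B & adj b x by apply: att; rewrite !inE eqxx.
have [l1 /setD1P[_ l1B] cB1] := noncut cB b0B (Bne _ b0B).
have [l2 /setD1P[l21 l2B] cB2] := noncut cB l1B (Bne _ l1B).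
have [u us Hu] := smaller l1 [:: x; y; z] l1B cB1 erefl U sub.
have [v vs Hv] := smaller l2 [:: x; y; z] l2B cB2 erefl U sub.
have Hu1 : {in B, forall b, adj b u = (b == l1)}.
  move=> b bB; apply/idP/eqP => [/(Hu b bB)//|->].
  by have [b' b'B b'u] := att _ us; rewrite -(Hu b').
have Hv1 : {in B, forall b, adj b v = (b == l2)}.
  move=> b bB; apply/idP/eqP => [/(Hv b bB)//|->].
  by have [b' b'B b'u] := att _ vs; rewrite -(Hv b').
have uv : u != v.
  apply: contraNneq l21 => e; rewrite eq_sym -(Hv1 l1) // -e Hu1 //.
have [w [ws wu wv]] : exists w, [/\ w \in [:: x; y; z], w != u & w != v].
  have [w ws] := exists_notin (t := [:: u; v]) U isT.
  by rewrite !inE negb_or => /andP[? ?]; exists w.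
have [bw bwB bww] := att _ ws.
have [[cu cv] cw] := (sub _ us, sub _ vs, sub _ ws).
(* The third vertex [w] is moved to position 0, as [attach_private] requires. *)
pose c' := rot (index w c) c.
have Hc' : icycle c' by apply: icycle_rot; rewrite ?index_mem.
have memc' t : (t \in c') = (t \in c) by rewrite mem_rot.
apply: (@attach_private k G c' B u v w l1 l2) => //; rewrite ?memc' //.
- by move=> b bB; rewrite memc' dis.
- by rewrite eq_sym.
- by rewrite eq_sym.
- by rewrite eq_sym.
- by rewrite /c' /rot (drop_nth w) ?index_mem // nth_index //= eqxx.
- by exists bw.
move=> b t bB; rewrite memc' => tc bt; apply/negPn/negP.
rewrite !inE !negb_or => /and3P[tu tv tw].
(* A fourth attachment [t] is impossible: one of [v], [w], [t] would be seen only from [l1], whose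
   sole neighbour on [c] is [u]. *)
have [||s ss Hs] := smaller l1 [:: v; w; t] l1B cB1 erefl.
- by rewrite /= !inE negb_or ![v == _]eq_sym wv tv eq_sym tw.
- by move=> s; rewrite !inE => /or3P[] /eqP->.
have l1s : adj l1 s.
  move: ss Hs; rewrite !inE => /or3P[] /eqP-> Hs.
  - by rewrite -(Hs l2) // Hv1.
  - by rewrite -(Hs bw).
  by rewrite -(Hs b).
have es : s = u.
  apply: (uniq_nbr l1) => //; last by rewrite Hu1.
  by move: ss; rewrite !inE => /or3P[] /eqP->.
by move: ss; rewrite es !inE ![u == _]eq_sym eq_sym (negPf uv) (negPf wu) (negPf tu).
Qed.

(** * Three connected sets between two vertices *)

Definition leg (G : sgraph) (x y : G) (D : {set G}) : Prop :=
  [/\ conn D, x \notin D, y \notin D,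
      exists2 u, u \in D & adj x u & exists2 u, u \in D & adj y u].

Lemma leg_sym (G : sgraph) (x y : G) (D : {set G}) : leg x y D -> leg y x D.
Proof. by case. Qed.

(** Unless [u] itself is on [C], it belongs to the component; the connected set [M] reaches [a]
    outside the component, and the first vertex where it leaves must lie on [C]. *)
Lemma component_attach (G : sgraph) (C M : {set G}) w a u v :
  w \notin C -> conn M -> a \in M -> a \in C -> u \in M ->
  v \in component (~: C) w -> adj u v ->
  exists q, [/\ q \in M, q \in C & exists2 b, b \in component (~: C) w & adj b q].
Proof.
move=> wC cM aM aC uM vB uv.
have sB : component (~: C) w \subset ~: C by apply: component_sub; rewrite inE.
have vC := subsetP sB _ vB.
have [uC|uC] := boolP (u \in C).
  by exists u; split=> //; exists v; rewrite // adj_sym.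
have uB : u \in component (~: C) w.
  by apply: component_closed vB vC _ _; rewrite ?inE // adj_sym.
have [|||p [q [/setIP[pM pB] qM qS pq]]] :=
  @conn_boundary G M (M :&: component (~: C) w) u a cM (subsetIl _ _).
- by rewrite inE uM.
- by [].
- by rewrite inE aM /=; apply/negP => /(subsetP sB); rewrite inE aC.
exists q; split=> //; last by exists p.
apply/negPn/negP => qC; move: qS; rewrite inE qM /= => /negP; apply.
by apply: component_closed pB (subsetP sB _ pB) _ pq; rewrite inE.
Qed.

(* A shortest path through D1, y and D3 between neighbours of x closes up at x to
   an induced cycle; the component of D2 in its complement sees x, D1 and
   y |: D3. *)
Lemma theta_no_edge k (G : sgraph) x y (D1 D2 D3 : {set G}) u v :
  all_icycles k G -> 4 < k -> x != y ->
  leg x y D1 -> leg x y D2 -> leg x y D3 ->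
  [disjoint D1 & D2] -> [disjoint D1 & D3] -> [disjoint D2 & D3] ->
  u \in D1 -> v \in D2 -> adj u v -> False.
Proof.
move=> Hk k4 xy [c1 x1 y1 [a1 a1D xa1] [b1 b1D yb1]] [c2 x2 y2 [a2 a2D xa2] [b2 b2D yb2]].
move=> [c3 x3 y3 [a3 a3D xa3] [b3 b3D yb3]] d12 d13 d23 uD vD uv.
(* When [x] and [y] are adjacent the shortest path may stop at [y] itself, so [y] is merged with
   [D3]. *)
pose M := [set y] :|: D3.
have cM : conn M := connU (conn1 y) c3 (set11 y) b3D yb3.
have yM : y \in M by rewrite !inE eqxx.
have cA : conn (M :|: D1) := connU cM c1 yM b1D yb1.
have dM : [disjoint D1 & M].
  rewrite disjoints_subset; apply/subsetP => w wD; rewrite !inE negb_or.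
  rewrite (disjointFr d13 wD) andbT; apply: contraNneq y1 => <- //.
have xM : x \notin M by rewrite !inE negb_or xy.
have [||||p [Hp p0 pA pS pT]] := @conn_geodesic G (M :|: D1)
  [set w in D1 | adj x w] [set w in M | adj x w] a1 a3 cA;
  rewrite ?inE ?a1D ?a3D ?xa1 ?xa3 ?orbT //.
have p0S : nth x p 0 \in D1 by have := pS x 0 p0; rewrite inE => /andP[].
have lp : (size p).-1 < size p by rewrite prednK.
have pLT : nth x p (size p).-1 \in M.
  by have := pT x _ lp; rewrite eqxx inE => /andP[].
have p1 : 1 < size p.
  rewrite ltn_neqAle p0 andbT; apply/eqP => e.
  by move: pLT; rewrite -e /= (disjointFr dM p0S).
have xp : x \notin p.
  by apply/negP => /pA; rewrite inE (negPf xM) (negPf x1).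
have adjx t : t < size p -> adj x (nth x p t) = (t == 0) || (t == (size p).-1).
  move=> tp; have := pS x t tp; have := pT x t tp; rewrite !inE => <- <-.
  have := pA _ (mem_nth x tp); rewrite !inE orbC.
  by case: (_ \in D1); case: (_ == y); case: (_ \in D3); case: adj.
have Hc : icycle ([:: x] ++ p).
  apply: icycle_cat => //.
  - exact: ipath1.
  - by rewrite /= xp; case: Hp.
  by move=> y0 [|i] // j _ jp /=; rewrite (set_nth_default x) // adjx.
pose C := [set w in x :: p].
have D2C w : w \in D2 -> w \notin C.
  move=> wD; rewrite !inE negb_or; apply/andP; split.
    by apply: contraNneq x2 => <-.
  apply/negP => /pA; rewrite !inE (disjointFl d12 wD) (disjointFr d23 wD) !orbF.
  by move/eqP=> e; rewrite -e wD in y2.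
pose B := component (~: C) v.
have D2B : D2 \subset B.
  by apply: conn_sub_component => //; apply/subsetP => w /D2C; rewrite in_setC.
have p0C : nth x p 0 \in C by rewrite !inE mem_nth ?orbT.
have pLC : nth x p (size p).-1 \in C by rewrite !inE mem_nth ?orbT.
have vC := D2C _ vD.
have vC' : v \in ~: C by rewrite in_setC.
have vB := subsetP D2B _ vD.
have b2B := subsetP D2B _ b2D.
(* The edge from [v] to [u] leads out of the component of [D2] into [D1], and the edge from [b2] to
   [y] leads into [M]; each yields an attachment on the cycle. *)
have [q1 [q1D q1C q1B]] := component_attach vC c1 p0S p0C uD vB uv.
have [q3 [q3D q3C q3B]] := component_attach vC cM pLT pLC yM b2B yb2.
apply: (@attach_le2 k G ([:: x] ++ p) B x q1 q3) => //.
- by move=> b /(subsetP (component_sub vC')); rewrite !inE.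
- exact: component_conn.
- rewrite /= !inE negb_or !andbT; apply/andP; split; first (apply/andP; split).
  + by apply: contraNneq x1 => ->.
  + by apply: contraNneq xM => ->.
  by apply: contraTneq q3D => <-; rewrite (disjointFr dM q1D).
- move=> w; rewrite !inE => /or3P[] /eqP->; first by rewrite eqxx.
    by move: q1C; rewrite !inE.
  by move: q3C; rewrite !inE.
move=> w; rewrite !inE => /or3P[] /eqP-> //.
by exists a2; rewrite ?(subsetP D2B) // adj_sym.
Qed.

(** Take a shortest path from [D1] to the other two legs avoiding [x] and [y]. Adding all of it but
    its last vertex to [D1] gives a leg still disjoint from the others yet adjacent to one of them,
    against [theta_no_edge]. *)
Lemma theta_separated k (G : sgraph) x y (D1 D2 D3 : {set G}) u v :
  all_icycles k G -> 4 < k -> x != y ->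
  leg x y D1 -> leg x y D2 -> leg x y D3 ->
  [disjoint D1 & D2] -> [disjoint D1 & D3] -> [disjoint D2 & D3] ->
  u \in D1 -> v \in D2 -> ~~ connect (restr (~: [set x; y])) u v.
Proof.
move=> Hk k4 xy L1 L2 L3 d12 d13 d23 uD vD; apply/negP => uv.
have [c1 x1 y1 xD1 yD1] := L1.
have [|||p [Hp p0 pA pS pT]] := @geodesic G _ D1 (D2 :|: D3) u v uv.
- by rewrite !inE negb_or; apply/andP; split; apply: contraTneq uD => ->.
- by [].
- by rewrite inE vD.
have lp : (size p).-1 < size p by rewrite prednK.
have p0S : nth x p 0 \in D1 by rewrite pS.
have pLT : nth x p (size p).-1 \in D2 :|: D3 by rewrite pT ?eqxx.
have p1 : 1 < size p.
  rewrite ltn_neqAle p0 andbT; apply/eqP => e.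
  by move: pLT; rewrite -e inE (disjointFr d12 p0S) (disjointFr d13 p0S).
have [l0 l2] : 0 < (size p).-1 /\ (size p).-2 < (size p).-1.
  by case: (size p) p1 => [|[|n]].
pose D := D1 :|: [set w in take (size p).-1 p].
have lastS : nth x p (size p).-2 \in D.
  by rewrite !inE mem_take_nth ?orbT ?leq_pred.
have lastadj : adj (nth x p (size p).-2) (nth x p (size p).-1).
  by rewrite (ipath_adj _ Hp); nat_lia.
have LD : leg x y D.
  split.
  - apply: (@connI _ _ _ (nth x p 0)) => //.
      by apply/conn_sorted/take_sorted/ipath_sorted.
    by rewrite inE mem_take_nth ?leq_pred.
  - rewrite !inE negb_or x1; apply/negP => /mem_take/pA; by rewrite !inE eqxx.
  - rewrite !inE negb_or y1; apply/negP => /mem_take/pA; by rewrite !inE eqxx orbT.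
  - by have [w wD xw] := xD1; exists w; rewrite // inE wD.
  by have [w wD xw] := yD1; exists w; rewrite // inE wD.
have dD w : w \in D -> w \notin D2 :|: D3.
  rewrite inE => /orP[wD|].
    by rewrite inE (disjointFr d12 wD) (disjointFr d13 wD).
  rewrite inE => /(nthP x)[t]; rewrite size_takel ?leq_pred // => tp <-.
  by rewrite nth_take // pT; nat_lia.
have dD2 : [disjoint D & D2].
  by rewrite disjoints_subset; apply/subsetP => w /dD; rewrite !inE negb_or => /andP[].
have dD3 : [disjoint D & D3].
  by rewrite disjoints_subset; apply/subsetP => w /dD; rewrite !inE negb_or => /andP[].
case/setUP: pLT => lD.
  exact: (@theta_no_edge k G x y D D2 D3 _ _ Hk k4 xy LD L2 L3 _ _ _ lastS lD).
apply: (@theta_no_edge k G x y D D3 D2 _ _ Hk k4 xy LD L3 L2 _ _ _ lastS lD) => //.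
by rewrite disjoint_sym.
Qed.

(** * Cages and pyramids *)

Lemma connected_induced (G : sgraph) (A : {set G}) :
  connected (induced A) <-> A != set0 /\ conn A.
Proof.
split=> [[c0 cA]|[/set0Pn[a aA] /connP cA]].
  split.
    by have /card_gt0P[u _] := c0; apply/set0Pn; exists (val u); exact: valP.
  apply/connP => x y xA yA.
  have /connectP[s] := cA (Sub x xA : induced A) (Sub y yA : induced A).
  rewrite -[x in connect _ x]/(val (Sub x xA : induced A)).
  rewrite -[y in connect _ _ y]/(val (Sub y yA : induced A)).
  move: (Sub x xA) (Sub y yA) => u v; elim: s u => [|w s IH] u /=.
    by move=> _ ->.
  case/andP=> uw ws ev; apply: connect_trans (IH w ws ev).
  by apply: connect1; apply/and3P; split; [exact: (valP u)|exact: (valP w)|].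
split; first by apply/card_gt0P; exists (Sub a aA : induced A).
move=> u v; have /connectP[s] := cA _ _ (valP u) (valP v).
elim: s u => [|w s IH] u /=; first by move=> _ /val_inj ->.
case/andP=> /and3P[_ wA uw] ws ev.
by apply: connect_trans (IH (Sub w wA) ws ev); apply: connect1.
Qed.

Lemma handshake (G : sgraph) : \sum_(x : G) degree x = (#|edges G|).*2.
Proof.
pose A := [set p : G * G | adj p.1 p.2].
have -> : \sum_(x : G) degree x = \sum_(p in A) 1.
  rewrite (eq_bigr (fun x => \sum_(y | adj x y) 1)); last first.
    by move=> x _; rewrite /degree -sum1_card; apply: eq_bigl => y; rewrite inE.
  by rewrite pair_big_dep; apply: eq_bigl => -[x y]; rewrite inE.
(* Ordered adjacent pairs are grouped by their underlying edge, two to each edge. *)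
rewrite (partition_big_imset (fun p : G * G => [set p.1; p.2])) /=.
rewrite -muln2 -sum_nat_const; apply: eq_bigr => e /imsetP[[u v]].
rewrite inE /= => uv ->; have nuv : u != v.
  by apply: contraTneq uv => ->; rewrite adj_irr.
rewrite sum1_card (_ : 2 = #|[set (u, v); (v, u)]|); last first.
  by rewrite cards2 xpair_eqE negb_and nuv.
apply: eq_card => -[a b]; rewrite !inE /= unfold_in /= inE /= !xpair_eqE.
apply/andP/orP => [[ab /eqP e1]|].
  have nab : a != b by apply: contraTneq ab => ->; rewrite adj_irr.
  have : a \in [set u; v] by rewrite -e1 !inE eqxx.
  have : b \in [set u; v] by rewrite -e1 !inE eqxx orbT.
  rewrite !inE => /orP[] /eqP eb /orP[] /eqP ea; rewrite ea eb ?eqxx in nab *;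
    by [|left|right].
case=> /andP[/eqP-> /eqP->]; split=> //; first by rewrite adj_sym.
by rewrite setUC.
Qed.

Lemma induced_cycle_map (G : sgraph) (S : {set G}) (c : seq (induced S)) :
  is_cycle c -> is_cycle (map val c).
Proof.
case=> c2 /andP[cc Uc]; split; first by rewrite size_map.
rewrite /ucycle map_inj_uniq ?Uc ?andbT; last exact: val_inj.
by case: c cc {c2 Uc} => // x s; rewrite /= -map_rcons path_map.
Qed.

Lemma induced_SC k (G : sgraph) (S : {set G}) :
  is_SC k G -> connected (induced S) -> is_SC k (induced S).
Proof.
move=> [_ hG] cS; split=> //; case: hG => [no|all].
  by left=> -[c /induced_cycle_map cc]; apply: no; exists (map val c).
right=> c [cc Hc]; rewrite -(size_map val); apply: all.
split; first exact: induced_cycle_map.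
have [_ /andP[_ Uc]] := cc.
move=> _ _ /mapP[u uc ->] /mapP[v vc ->] uv.
rewrite !(next_map val_inj) //.
by case: (Hc u v uc vc uv) => <-; [left|right].
Qed.

(** The common shape of cages and pyramids: the [P i] are the interiors of three induced paths
    between [x] and [y], without edges between different interiors. *)
Definition fan (G : sgraph) (x y : G) (P : 'I_3 -> seq G) : Prop :=
  [/\ x != y,
      forall i, [/\ ipath (P i), 0 < size (P i), x \notin P i & y \notin P i],
      forall i x0 t, t < size (P i) -> adj x (nth x0 (P i) t) = (t == 0),
      forall i x0 t, t < size (P i) -> adj y (nth x0 (P i) t) = (t == (size (P i)).-1) &
      forall i j u v, i != j -> u \in P i -> v \in P j -> (u != v) && ~~ adj u v].

Lemma third_ord (i j : 'I_3) : exists l : 'I_3, (l != i) && (l != j).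
Proof.
apply/existsP; move: i j.
by case=> [[|[|[|i]]] // hi] [[|[|[|j]]] // hj]; apply/existsP;
  do [exists (Ordinal (isT : 0 < 3)); done | exists (Ordinal (isT : 1 < 3)); done
     | exists (Ordinal (isT : 2 < 3)); done].
Qed.

Definition theta (G : sgraph) (x y : G) (D : 'I_3 -> {set G}) : Prop :=
  [/\ x != y, forall i, leg x y (D i) &
      forall i j, i != j -> [disjoint D i & D j]].

(** A shortest path is chosen inside each leg; an edge between two of them is excluded by
    [theta_no_edge] with the remaining leg as third set. *)
Lemma theta_fan k (G : sgraph) x y (D : 'I_3 -> {set G}) :
  all_icycles k G -> 4 < k -> theta x y D -> exists P, fan x y P.
Proof.
move=> Hk k4 [xy L dD].
have [P HP] : exists P : 'I_3 -> seq G, forall i,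
    [/\ ipath (P i), 0 < size (P i), {subset P i <= D i},
      meets_at [set u in D i | adj x u] (P i) 0 &
      meets_at [set u in D i | adj y u] (P i) (size (P i)).-1].
  apply: (@fin_all_exists _ (fun=> seq G) (fun i p => [/\ ipath p, 0 < size p,
    {subset p <= D i}, meets_at [set u in D i | adj x u] p 0 &
    meets_at [set u in D i | adj y u] p (size p).-1])) => i.
  have [cD _ _ [u uD xu] [v vD yv]] := L i.
  by apply: (@conn_geodesic G (D i) _ _ u v); rewrite ?inE ?uD ?vD.
exists P; split=> //.
- move=> i; have [Hp p0 pD _ _] := HP i; have [_ xD yD _ _] := L i.
  by split=> //; apply/negP => /pD; rewrite ?(negPf xD) ?(negPf yD).
- move=> i x0 t tp; have [_ _ pD pS _] := HP i.
  by rewrite -(pS x0 t tp) inE pD ?mem_nth.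
- move=> i x0 t tp; have [_ _ pD _ pT] := HP i.
  by rewrite -(pT x0 t tp) inE pD ?mem_nth.
move=> i j u v ij; have [_ _ piD _ _] := HP i; have [_ _ pjD _ _] := HP j.
move=> /piD uD /pjD vD; apply/andP; split.
  by apply: contraTneq vD => <-; rewrite (disjointFr (dD _ _ ij)).
apply/negP => uv; have [l /andP[li lj]] := third_ord i j.
apply: (@theta_no_edge k G x y (D i) (D j) (D l) u v) => //; apply: dD => //.
  by rewrite eq_sym.
by rewrite eq_sym.
Qed.

(** Two of the paths close up through [x] and [y] to an induced cycle. *)
Lemma fan_size_nonadj k (G : sgraph) x y (P : 'I_3 -> seq G) i j :
  all_icycles k G -> fan x y P -> ~~ adj x y -> i != j ->
  size (P i) + size (P j) + 2 = k.
Proof.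
move=> Hk [xy HP Hx Hy Hij] nxy ij.
have [Hi i0 xi yi] := HP i; have [Hj j0 xj yj] := HP j.
suff /Hk : icycle ((x :: P i) ++ (y :: rev (P j))).
  by rewrite size_cat /= size_rev => <-; lia.
apply: icycle_cat => //.
- by apply: ipath_cons => // x0 t; exact: Hx.
- apply: ipath_cons; rewrite ?mem_rev ?size_rev //; first exact: ipath_rev.
  move=> x0 t tp; rewrite nth_rev // Hy; lia.
- rewrite cat_uniq; apply/and3P; split; first by rewrite /= xi; case: Hi.
  + apply/hasPn => v; rewrite !inE mem_rev negb_or => /predU1P[->|vj].
      by rewrite eq_sym xy.
    apply/andP; split; first by apply: contraNneq xj => <-.
    by apply/negP => vi; have := Hij i j v v ij vi vj; rewrite eqxx.
  by rewrite /= mem_rev yj rev_uniq; case: Hj.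
- by rewrite /= size_rev; lia.
move=> x0 [|s] [|t] //=; rewrite ?size_rev ?ltnS => sp tp.
- rewrite (negPf nxy); lia.
- rewrite nth_rev // Hx; lia.
- rewrite adj_sym Hy //; lia.
rewrite nth_rev // (_ : adj _ _ = false); first lia.
apply/negbTE; have := @Hij i j (nth x0 (P i) s) (nth x0 (P j) (size (P j) - t.+1)) ij.
rewrite !mem_nth //; last by rewrite ltn_subrL /=.
by move=> /(_ isT isT) /andP[].
Qed.

(** Each path closes up with the edge between [x] and [y] to an induced cycle. *)
Lemma fan_size_adj k (G : sgraph) x y (P : 'I_3 -> seq G) i :
  all_icycles k G -> fan x y P -> adj x y -> size (P i) + 2 = k.
Proof.
move=> Hk [xy HP Hx Hy Hij] axy.
have [Hi i0 xi yi] := HP i.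
suff /Hk : icycle ([:: y; x] ++ P i) by rewrite /= => <-; lia.
apply: icycle_cat => //.
- apply: ipath_cons; first exact: ipath1; first by rewrite inE eq_sym.
  by move=> x0 [|t] //= _; rewrite adj_sym.
- rewrite /= !inE negb_or yi eq_sym xy xi /=; by case: Hi.
move=> x0 [|[|s]] t //= _ tp; [rewrite Hy //|rewrite Hx //]; lia.
Qed.

(** Any two of the three paths have [k - 2] vertices together, so each has [k/2 - 1] and [k] is
    even; this is [l - 2] for [l = k/2 + 1]. *)
Lemma fan_cage k (G : sgraph) x y (P : 'I_3 -> seq G) :
  all_icycles k G -> 4 < k -> fan x y P -> ~~ adj x y ->
  ~~ odd k /\ contains_induced G (CAGE 3 (k./2 + 1)).
Proof.
move=> Hk k4 HF nxy; have [xy HP Hx Hy Hij] := HF.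
have sz i : (size (P i)).+1.*2 = k.
  have [j /andP[ji _]] := third_ord i i; have [l /andP[li lj]] := third_ord i j.
  have := fan_size_nonadj Hk HF nxy ji; have := fan_size_nonadj Hk HF nxy li.
  have := fan_size_nonadj Hk HF nxy lj; lia.
split; first by rewrite -(sz ord0) odd_double.
have szP i : size (P i) = k./2 + 1 - 2 by have := sz i; lia.
pose f (a : CAGE 3 (k./2 + 1)) : G := match a with
  | inl false => x | inl true => y | inr (i, j) => nth x (P i) j end.
have fmem i (j : 'I_(k./2 + 1 - 2)) : nth x (P i) j \in P i.
  by rewrite mem_nth // szP.
exists f; split.
  case=> [[]|[i j]] [[]|[i' j']] //=.
  - by move/eqP; rewrite eq_sym (negPf xy).
  - by move=> e; have [_ _ _] := HP i'; rewrite e fmem.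
  - by move/eqP; rewrite (negPf xy).
  - by move=> e; have [_ _] := HP i'; rewrite {1}e fmem.
  - by move=> e; have [_ _ _] := HP i; rewrite -e fmem.
  - by move=> e; have [_ _] := HP i; rewrite -{1}e fmem.
  have [->|ii'] := eqVneq i i'; last first.
    by move=> e; have := Hij _ _ _ _ ii' (fmem i j) (fmem i' j'); rewrite e eqxx.
  have [[Ui _] _ _ _] := HP i'.
  by move/eqP; rewrite nth_uniq ?szP // => /eqP/val_inj ->.
case=> [[]|[i j]] [[]|[i' j']] //=; rewrite /cage_adj /=.
- by rewrite adj_irr.
- by rewrite adj_sym (negPf nxy).
- rewrite Hy ?szP //; have := ltn_ord j'; lia.
- by rewrite (negPf nxy).
- by rewrite adj_irr.
- by rewrite Hx ?szP // orbF.
- rewrite adj_sym Hy ?szP //; have := ltn_ord j; lia.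
- by rewrite adj_sym Hx ?szP.
have [<-|ii'] := eqVneq i i'; last first.
  have /andP[_ /negbTE->] := Hij _ _ _ _ ii' (fmem i j) (fmem i' j').
  by [].
have [Hi _ _ _] := HP i.
by rewrite (ipath_adj _ Hi) ?szP ?eqxx //=; lia.
Qed.

(** * Counting vertices and degrees along lists *)

Lemma uniq_flatten_map (I T : eqType) (P : I -> seq T) (s : seq I) :
  uniq s -> (forall i, uniq (P i)) ->
  (forall i j u, i != j -> u \in P i -> u \notin P j) -> uniq (flatten (map P s)).
Proof.
move=> Us UP dP; elim: s Us => //= i s IH /andP[is_ Us].
rewrite cat_uniq UP IH // andbT; apply/hasPn => u /flatten_mapP[j js uj].
by apply: dP uj; apply: contraNneq is_ => <-.
Qed.

Lemma count_nth (T : Type) (a : pred T) (b : pred nat) x0 (p : seq T) :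
  (forall t, t < size p -> a (nth x0 p t) = b t) ->
  count a p = count b (iota 0 (size p)).
Proof.
move=> H; rewrite -{1}(mkseq_nth x0 p) /mkseq count_map.
by apply: eq_in_count => t; rewrite mem_iota /= => tp; rewrite H.
Qed.

Lemma count_nth_eq (T : Type) (a : pred T) x0 (p : seq T) n :
  (forall t, t < size p -> a (nth x0 p t) = (t == n)) -> count a p = (n < size p).
Proof.
move=> H; rewrite (count_nth (b := pred1 n) H) count_uniq_mem ?iota_uniq //.
by rewrite mem_iota.
Qed.

Lemma card_filter_seq (T : finType) (L : seq T) (a : pred T) : uniq L ->
  #|[set w in [set u in L] | a w]| = count a L.
Proof.
move=> UL; rewrite -size_filter -(card_uniqP (filter_uniq a UL)).
by apply: eq_card => w; rewrite !inE mem_filter andbC.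
Qed.

Lemma card_induced (G : sgraph) (S : {set G}) : #|induced S| = #|S|.
Proof. by rewrite card_sig; apply: eq_card => x; rewrite !inE. Qed.

Lemma degree_induced (G : sgraph) (S : {set G}) (v : induced S) :
  degree v = #|[set w in S | adj (val v) w]|.
Proof.
rewrite /degree -(card_imset _ val_inj); apply: eq_card => w.
apply/imsetP/idP => [[u]|]; first by rewrite !inE => vu ->; rewrite (valP u).
rewrite inE => /andP[wS vw]; exists (Sub w wS : induced S) => //.
by rewrite inE.
Qed.

(** The pyramid is induced on [x], [y] and the three paths. Degrees are counted along the
    duplicate-free list [L], and the number of edges follows by [handshake]. *)
Lemma fan_pyramid k (G : sgraph) x y (P : 'I_3 -> seq G) :
  is_SC k G -> 4 < k -> fan x y P -> adj x y ->
  exists S : {set G}, is_3_Ck_pyramid k (induced S).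
Proof.
move=> hG k4 HF axy; have Hk := SC_icycles hG.
have [xy HP Hx Hy Hij] := HF.
have sz i : size (P i) + 2 = k := fan_size_adj i Hk HF axy.
pose M := flatten (map P (enum 'I_3)); pose L := x :: y :: M.
have memM u : u \in M -> exists i, u \in P i.
  by case/flatten_mapP => i _ ui; exists i.
have PM i u : u \in P i -> u \in M.
  by move=> ui; apply/flatten_mapP; exists i; rewrite ?mem_enum.
have UL : uniq L.
  rewrite /L /= inE negb_or xy /=; apply/and3P; split.
  - by apply/negP => /memM[i]; have [_ _ /negPf->] := HP i.
  - by apply/negP => /memM[i]; have [_ _ _ /negPf->] := HP i.
  apply: uniq_flatten_map; first exact: enum_uniq.
    by move=> i; have [[]] := HP i.
  move=> i j u ij ui; apply/negP => uj.
  by have := Hij _ _ _ _ ij ui uj; rewrite eqxx.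
have countL a : count a L = a x + (a y + \sum_(i < 3) count a (P i)).
  by rewrite /L /= count_flatten sumnE !big_map.
pose S := [set u in L]; exists S.
have xS : x \in S by rewrite !inE eqxx.
have yS : y \in S by rewrite !inE eqxx orbT.
have PS i u : u \in P i -> u \in S by move=> /PM uM; rewrite !inE uM !orbT.
have cS : connected (induced S).
  apply/connected_induced; split; first by apply/set0Pn; exists x.
  apply: (@conn_from _ _ x) => v; rewrite !inE => /or3P[/eqP->|/eqP->|/memM[i vi]].
  - exact: connect0.
  - by apply: connect1; apply/and3P.
  have [Hi _ xi _] := HP i.
  have pi : path (@adj G) x (P i).
    by apply: (@ipath_sorted G (x :: P i)); apply: ipath_cons => // x0 t; apply: Hx.
  have /connP := conn_path pi; move/(_ x v); rewrite !inE eqxx vi orbT.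
  move=> /(_ isT isT); apply: connect_restrS.
  by apply/subsetP => w; rewrite inE in_cons => /predU1P[->//|/PS].
have cardS : #|induced S| = 3 * (k - 2) + 2.
  rewrite card_induced cardsE (card_uniqP UL) -[size L](count_predT L) countL.
  rewrite (eq_bigr (fun=> k - 2)) => [|i _]; last by rewrite count_predT -(sz i); lia.
  by rewrite sum_nat_const card_ord /=; lia.
have deg (v : induced S) : degree v = count (adj (val v)) L.
  by rewrite degree_induced card_filter_seq.
pose a : induced S := Sub x xS; pose b : induced S := Sub y yS.
have dega : degree a = 4.
  rewrite deg countL /= adj_irr axy (eq_bigr (fun=> 1)) => [|i _].
    by rewrite sum_nat_const card_ord.
  rewrite (count_nth_eq (n := 0) (x0 := x)); last by move=> t; exact: Hx.
  by have [_ ->] := HP i.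
have degb : degree b = 4.
  rewrite deg countL /= adj_irr adj_sym axy (eq_bigr (fun=> 1)) => [|i _].
    by rewrite sum_nat_const card_ord.
  rewrite (count_nth_eq (n := (size (P i)).-1) (x0 := x)); last by move=> t; exact: Hy.
  by have [_ p0 _ _] := HP i; rewrite prednK ?leqnn.
have deg2 (v : induced S) : v != a -> v != b -> degree v = 2.
  rewrite -!val_eqE /= => va vb; have := valP v; rewrite inE !in_cons.
  rewrite (negPf va) (negPf vb) /= => /memM[i vi]; rewrite deg countL.
  have [Hi p0 _ _] := HP i.
  rewrite (bigD1 i) //= big1 ?addn0 => [|j ji]; last first.
    apply/eqP; rewrite -leqn0 leqNgt -has_count; apply/hasPn => u uj.
    have ij : i != j by rewrite eq_sym.
    by have /andP[] := Hij i j (val v) u ij vi uj.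
  have /(nthP x)[t tp <-] := vi.
  rewrite ![adj (nth _ _ _) _]adj_sym Hx ?Hy //.
  (* On its own path the vertex at position [t] has neighbours at [t + 1] and, for [t > 0], at
     [t - 1]; a missing one at either end is made up by [y] or [x]. *)
  rewrite (count_nth (x0 := x) (b := predU (pred1 t.+1) (fun s => (0 < t) && (s == t.-1)))).
    have := count_predUI (pred1 t.+1) (fun s => (0 < t) && (s == t.-1)) (iota 0 (size (P i))).
    rewrite (eq_count (a1 := predI _ _) (a2 := pred0)) ?count_pred0 ?addn0;
      last by move=> s /=; lia.
    move=> ->.
    rewrite count_uniq_mem ?iota_uniq // mem_iota add0n leq0n /=.
    case: (posnP t) => t0 /=; rewrite ?count_pred0.
      rewrite t0; lia.
    have aux m : t < m -> (t == m.-1) + (t.+1 < m) = 1 by lia.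
    rewrite (count_uniq_mem t.-1) ?iota_uniq // mem_iota !add0n leq0n /=.
    by rewrite (leq_ltn_trans (leq_pred t) tp) addnA aux.
  move=> s sp; rewrite (ipath_adj _ Hi) //=; lia.
split=> //.
- exact: induced_SC.
(* The degree sum is [8 + 6 * (k - 2)], twice the required number of edges. *)
- have := handshake (induced S).
  rewrite (bigD1 a) //= (bigD1 b) /=; last by rewrite -val_eqE /= eq_sym.
  rewrite (eq_bigr (fun=> 2)) => [|v /andP[va vb]]; last exact: deg2.
  have : \sum_(v : induced S) 2 = #|induced S| * 2 by rewrite sum_nat_const.
  rewrite (bigD1 a) //= (bigD1 b) /=; last by rewrite -val_eqE /= eq_sym.
  by rewrite dega degb cardS; lia.
by exists a, b.
Qed.

(** * Ears on a longest cycle *)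

Lemma conn_compl1 (G : sgraph) (x : G) : kconnected 2 G -> conn (~: [set x]).
Proof. by case=> _ /(_ [set x]); rewrite cards1 => /(_ isT)/connected_induced[]. Qed.

Lemma kconn2_conn (G : sgraph) : kconnected 2 G -> conn [set: G].
Proof.
by case=> _ /(_ set0); rewrite cards0 setC0 => /(_ isT)/connected_induced[].
Qed.

Definition closed_walk (G : sgraph) (c : seq G) : bool :=
  [&& 1 < size c, cycle (@adj G) c & uniq c].

Lemma theta3 (G : sgraph) (x y : G) (D1 D2 D3 : {set G}) : x != y ->
  leg x y D1 -> leg x y D2 -> leg x y D3 ->
  [disjoint D1 & D2] -> [disjoint D1 & D3] -> [disjoint D2 & D3] ->
  theta x y (fun i : 'I_3 => nth set0 [:: D1; D2; D3] i).
Proof.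
move=> xy L1 L2 L3 d12 d13 d23; split=> //; first by case=> [[|[|[|i]]] hi].
by case=> [[|[|[|i]]] hi] [[|[|[|j]]] hj] //= _; rewrite disjoint_sym.
Qed.

Lemma seg_leg (G : sgraph) (x y : G) (s : seq G) : path (@adj G) x (rcons s y) ->
  s != [::] -> x \notin s -> y \notin s -> leg x y [set v in s].
Proof.
case: s => // v s; rewrite rcons_path /= => /andP[/andP[xv vs] sy] _ xs ys.
split; rewrite ?inE //; first exact: conn_path.
  by exists v; rewrite // !inE eqxx.
by exists (last v s); [rewrite in_set mem_last|rewrite adj_sym].
Qed.

(** If a longest closed walk misses a vertex, some component outside it has two attachments [x] and
    [y] on it. By maximality these are not consecutive, so the two arcs between them and the
    component are three legs. *)
Lemma kconn2_theta (G : sgraph) : kconnected 2 G ->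
  hamiltonian G \/ exists x y (D : 'I_3 -> {set G}), theta x y D.
Proof.
move=> G2; have [cardG _] := G2; have cG := kconn2_conn G2.
have [u0 [v0 uv0]] : exists u v : G, adj u v.
  have /card_gt0P[u _] : 0 < #|G| by lia.
  have : [set: G] != [set u].
    by apply/eqP => e; move: cardG; rewrite -cardsT e cards1.
  case/(noncut cG (in_setT u)) => v; rewrite !inE andbT => vu _.
  have [||||a [b [_ _ _ ab]]] := @conn_boundary G setT [set u] u v cG;
    rewrite ?subsetT ?inE //.
  by exists a, b.
have r0 : closed_walk [:: u0; v0].
  rewrite /closed_walk /= uv0 adj_sym uv0 inE !andbT; apply: contraTneq uv0 => ->.
  by rewrite adj_irr.
have bnd (p : seq G) : closed_walk p -> size p < #|G|.+1.
  by case/and3P => _ _ /card_uniqP <-; rewrite ltnS max_card.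
have ex : exists n, [exists t : n.-tuple G, closed_walk t].
  by exists 2; apply/existsP; exists [tuple u0; v0].
have ub n : [exists t : n.-tuple G, closed_walk t] -> n <= #|G|.
  by case/existsP => t /bnd; rewrite size_tuple.
have [c rc cmax] : exists2 c : seq G, closed_walk c &
    forall p : seq G, closed_walk p -> size p <= size c.
  case: (ex_maxnP ex ub) => m /existsP[t rt] mmax; exists t => // p rp.
  by rewrite size_tuple; apply: mmax; apply/existsP; exists (in_tuple p).
have /and3P[c1 cc Uc] := rc.
have [/forallP all|/forallPn[w wc]] := boolP [forall w, w \in c].
  (* There are more than two vertices, so a spanning closed walk is a genuine cycle. *)
  left; exists c; split=> //; split; last by rewrite /ucycle cc.
  by rewrite -(card_uniqP Uc) (eq_card (B := G)) // => w; rewrite all.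
right.
pose C := [set u in c].
have c0 : 0 < size c by lia.
have hc : nth w c 0 \in C by rewrite inE mem_nth.
have [||||x [u [xC _ uC xu]]] := @conn_boundary G setT C (nth w c 0) w cG;
  rewrite ?subsetT ?in_setT //; first by rewrite inE.
have uC' : u \in ~: C by rewrite inE.
pose D3 := component (~: C) u.
have D3C : D3 \subset ~: C := component_sub uC'.
have xc : x \in c by move: xC; rewrite inE.
have [n s ec] := rot_to xc.
have Ur : uniq (x :: s) by rewrite -ec rot_uniq.
have cr : cycle (@adj G) (x :: s) by rewrite -ec rot_cycle.
have memr v : (v \in c) = (v \in x :: s) by rewrite -ec mem_rot.
have szr : size (x :: s) = size c by rewrite -ec size_rot.
have [z zs] : exists z, z \in s.
  by case: s szr c1 {ec Ur cr memr} => [<-//|z s] _ _; exists z; rewrite inE eqxx.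
have [||||u' [y [u'D yx yD u'y]]] := @conn_boundary G (~: [set x]) D3 u z (conn_compl1 x G2).
- by apply/subsetP => v /(subsetP D3C); rewrite !inE; apply: contraNneq => ->.
- exact: component_id.
- by rewrite !inE; apply: contraTneq zs => ->; case/andP: Ur.
- by apply/negP => /(subsetP D3C); rewrite !inE memr inE zs orbT.
have yC : y \in C.
  apply/negPn/negP => yC; move/negP: yD; apply.
  by apply: component_closed u'D (subsetP D3C _ u'D) _ u'y; rewrite inE.
have ys : y \in s.
  by move: yC yx; rewrite !inE memr inE => /predU1P[->|//]; rewrite eqxx.
have D3c v : v \in D3 -> v \notin x :: s.
  by move=> /(subsetP D3C); rewrite !inE memr.
have [px xD3 yD3] : [/\ conn D3, x \notin D3 & y \notin D3].
  by split; [exact: component_conn| |]; apply: contraTN isT => /(subsetP D3C); rewrite inE ?xC ?yC.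
case/splitPr: ys ec Ur cr memr szr zs D3c => s1 s2 _ Ur cr _ szr _ D3c.
have [||||p [Hp p0 pD pS pT]] :=
  @conn_geodesic G D3 [set v in D3 | adj x v] [set v in D3 | adj y v] u u' px.
- exact: component_id.
- by rewrite in_set component_id.
- by [].
- by rewrite in_set u'D adj_sym.
have xpy : path (@adj G) x (rcons p y).
  case: p Hp p0 pD pS pT => // v p Hp _ pD /(_ x 0 isT) + /(_ x (size p) (ltnSn _)).
  rewrite -[size p]/(size (v :: p)).-1 nth_last /= !inE !eqxx => /andP[_ ->].
  by case/andP=> _ yl; rewrite rcons_path; have /= -> := ipath_sorted Hp; rewrite adj_sym.
have dp : ~~ has [in p] (x :: s1 ++ y :: s2).
  by apply/hasPn => v vs; apply: contraL vs => /pD/D3c.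
have Up : uniq p by case: Hp.
move: cr; rewrite /= rcons_cat cat_path rcons_cons /= => /and3P[xs1 ys1 ys2].
(* If nothing lies between [x] and [y] on this side, replacing their edge by [p] lengthens the
   walk. *)
have s1n : s1 != [::].
  apply/eqP => e; rewrite e /= in ys1 ys2 Ur szr dp.
  have /cmax : closed_walk (x :: p ++ y :: s2).
    apply/and3P; split; first by rewrite /= size_cat /= addnS.
      by rewrite /= rcons_cat rcons_cons -cat_rcons cat_path xpy last_rcons.
    rewrite (perm_uniq (permEl (perm_catCA [:: x] p (y :: s2)))) cat_uniq Up dp.
    exact: Ur.
  by rewrite -szr /= size_cat /=; clear -p0; lia.
(* The same on the other side, with [p] traversed backwards. *)
have s2n : s2 != [::].
  apply/eqP => e; rewrite e in ys2 Ur szr dp.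
  have /cmax : closed_walk (x :: s1 ++ y :: rev p).
    apply/and3P; split; first by rewrite /= size_cat /= addnS.
      rewrite /= rcons_cat rcons_cons cat_path xs1 /= ys1 /=.
      have : sorted (@adj G) (rev (x :: rcons p y)).
        by rewrite rev_sorted (eq_sorted (e' := @adj G)) //= => a b; rewrite adj_sym.
      by rewrite rev_cons rev_rcons.
    rewrite -cat_rcons -cat_cons cat_uniq rev_uniq Up andbT -cats1.
    rewrite Ur /=; apply/hasPn => v; rewrite mem_rev => vp.
    by move/hasPn: dp => dp; apply/negP => /dp; rewrite vp.
  by rewrite -szr /= !size_cat /= size_rev; clear -p0; lia.
have := Ur; rewrite /= mem_cat inE !negb_or cat_uniq /= negb_or.
case/and4P=> /and3P[xs1' xy xs2] Us1 /andP[ys1' ds] /andP[ys2' Us2].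
exists x, y, (fun i : 'I_3 => nth set0 [:: [set v in s1]; [set v in s2]; D3] i).
apply: theta3 => //.
- by apply: seg_leg => //; rewrite rcons_path xs1.
- exact/leg_sym/seg_leg.
- by split=> //; [exists u; rewrite ?component_id|exists u'; rewrite // adj_sym].
- rewrite disjoints_subset; apply/subsetP => v; rewrite !inE => vs1.
  by apply: contraL vs1 => vs2; exact: (hasPn ds).
- rewrite disjoint_sym disjoints_subset; apply/subsetP => v /D3c.
  by rewrite !inE mem_cat inE !negb_or => /and3P[].
rewrite disjoint_sym disjoints_subset; apply/subsetP => v /D3c.
by rewrite !inE mem_cat inE !negb_or => /and4P[].
Qed.

Lemma hamiltonian_if k (G : sgraph) : is_SC k G -> 4 < k -> kconnected 2 G ->
  (~~ odd k -> ~ contains_induced G (CAGE 3 (k./2 + 1))) ->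
  (forall P : sgraph, is_3_Ck_pyramid k P -> ~ contains_induced G P) ->
  hamiltonian G.
Proof.
move=> hG k4 G2 nocage nopyr; have Hk := SC_icycles hG.
case: (kconn2_theta G2) => // -[x [y [D /(theta_fan Hk k4)[P HP]]]]; exfalso.
have [axy|nxy] := boolP (adj x y).
  have [S HS] := fan_pyramid hG k4 HP axy; apply: nopyr HS _.
  by exists val; split=> //; exact: val_inj.
by have [ok] := fan_cage Hk k4 HP nxy; exact: nocage.
Qed.

(** * Hamiltonian graphs *)

(** Deleting one vertex from a spanning cycle leaves a spanning path. *)
Lemma hamiltonian_kconn2 (G : sgraph) : connected G -> hamiltonian G -> kconnected 2 G.
Proof.
move=> [G0 cG] [c [[c2 /andP[cc Uc]] all]].
split; first by rewrite (leq_trans c2) // -(card_uniqP Uc) max_card.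
move=> X X2; apply/connected_induced.
have [X0|X1] : X = set0 \/ #|X| = 1.
  by case: (posnP #|X|) => [/cards0_eq|?]; [left|right; lia].
  rewrite X0 setC0; split; first by rewrite -card_gt0 cardsT.
  apply/connP => x y _ _; apply: connect_sub (cG x y) => u v uv.
  by apply: connect1; rewrite /= !in_setT.
have /eqP/cards1P[v ->] := X1.
have [n s ec] := rot_to (all v).
have cr : cycle (@adj G) (v :: s) by rewrite -ec rot_cycle.
have Ur : uniq (v :: s) by rewrite -ec rot_uniq.
have es : ~: [set v] = [set u in s].
  apply/setP => u; have := all u; rewrite -(mem_rot n) ec !inE.
  by case: eqP => [-> _|//]; case/andP: Ur => /negPf->.
have sz : 2 < size (v :: s) by rewrite -ec size_rot.
rewrite es; split.
  by case: s {ec cr Ur es} sz => // u s _; apply/set0Pn; exists u; rewrite !inE eqxx.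
apply: conn_sorted; move: cr; rewrite /= rcons_path => /andP[+ _].
by case: s {ec Ur es sz} => //= u s /andP[].
Qed.

(** Removing [x] and [y] cuts the spanning cycle into two arcs [s1] and [s2]. Of three vertices
    chosen in the three legs, two lie on the same arc and are connected there, against
    [theta_separated]. *)
Lemma hamiltonian_no_theta k (G : sgraph) x y (D : 'I_3 -> {set G}) :
  all_icycles k G -> 4 < k -> hamiltonian G -> theta x y D -> False.
Proof.
move=> Hk k4 [c [[c2 /andP[cc Uc]] all]] [xy L dD].
have [n s ec] := rot_to (all x).
have cr : path (@adj G) x (rcons s x) by rewrite -[path _ _ _]/(cycle _ (x :: s)) -ec rot_cycle.
have Ur : uniq (x :: s) by rewrite -ec rot_uniq.
have memr v : v \in x :: s by rewrite -ec mem_rot.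
have ys : y \in s by have := memr y; rewrite inE eq_sym (negPf xy).
case/splitPr: ys Ur cr memr {ec} => s1 s2.
rewrite rcons_cat rcons_cons cat_path [path _ (last x s1) _]/= => Ur /and3P[xs1 _ ys2] memr.
have [d Hd] : exists d : 'I_3 -> G, forall i, d i \in D i.
  apply: (@fin_all_exists _ (fun=> vertex G) (fun i u => u \in D i)) => i.
  by have [_ _ _ [u]] := L i; exists u.
have ds i : (d i \in s1) || (d i \in s2).
  have [_ xD yD _ _] := L i; have := memr (d i).
  rewrite in_cons mem_cat in_cons => /or4P[/eqP e|->//|/eqP e|->]; last by rewrite orbT.
    by move: xD; rewrite -e Hd.
  by move: yD; rewrite -e Hd.
have : uniq (s1 ++ s2) /\ {in s1 ++ s2, forall v, v \in ~: [set x; y]}.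
  move: Ur; rewrite /= mem_cat inE !negb_or cat_uniq /= negb_or.
  case/and4P=> /and3P[xs1' _ xs2'] U1 /andP[ys1 dis] /andP[ys2' U2].
  rewrite cat_uniq U1 dis U2; split=> // v; rewrite mem_cat !inE negb_or.
  by case/orP=> vs; apply/andP; split; apply: contraTneq vs => ->.
case=> _ sub.
have c1 u v : u \in s1 -> v \in s1 -> connect (restr (~: [set x; y])) u v.
  move=> us vs; have /connP cs : conn [set w in s1].
    by apply: conn_sorted; move: xs1; case: (s1) => //= w s' /andP[].
  apply: connect_restrS (cs u v _ _); rewrite ?inE //.
  by apply/subsetP => w; rewrite inE => ws; apply: sub; rewrite mem_cat ws.
have c2' u v : u \in s2 -> v \in s2 -> connect (restr (~: [set x; y])) u v.
  move=> us vs; have /connP cs : conn [set w in s2].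
    apply: conn_sorted; move: ys2; rewrite rcons_path => /andP[+ _].
    by case: (s2) => //= w s' /andP[].
  apply: connect_restrS (cs u v _ _); rewrite ?inE //.
  by apply/subsetP => w; rewrite inE => ws; apply: sub; rewrite mem_cat ws orbT.
have sep i j : i != j -> ~~ connect (restr (~: [set x; y])) (d i) (d j).
  move=> ij; have [l /andP[li lj]] := third_ord i j.
  by apply: (@theta_separated k G x y (D i) (D j) (D l)) => //; apply: dD;
    rewrite // eq_sym.
have := sep (Ordinal (isT : 0 < 3)) (Ordinal (isT : 1 < 3)) isT.
have := sep (Ordinal (isT : 0 < 3)) (Ordinal (isT : 2 < 3)) isT.
have := sep (Ordinal (isT : 1 < 3)) (Ordinal (isT : 2 < 3)) isT.
have := ds (Ordinal (isT : 0 < 3)); have := ds (Ordinal (isT : 1 < 3)).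
have := ds (Ordinal (isT : 2 < 3)).
by case/orP=> m2; case/orP=> m1; case/orP=> m0 N12 N02 N01;
  first [by case/negP: N01; apply: c1 | by case/negP: N01; apply: c2'
       | by case/negP: N02; apply: c1 | by case/negP: N02; apply: c2'
       | by case/negP: N12; apply: c1 | by case/negP: N12; apply: c2'].
Qed.

(** * Three legs inside cages and pyramids *)

Lemma theta_embed (H G : sgraph) (f : H -> G) x y (D : 'I_3 -> {set H}) :
  injective f -> (forall u v, adj (f u) (f v) = adj u v) -> theta x y D ->
  theta (f x) (f y) (fun i => f @: D i).
Proof.
move=> fI fA [xy L dD]; split=> [|i|i j ij]; first by rewrite (inj_eq fI).
  have [/connP cD xD yD [u uD xu] [v vD yv]] := L i.
  split; rewrite ?mem_imset //; last 2 first.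
  - by exists (f u); rewrite ?fA ?imset_f.
  - by exists (f v); rewrite ?fA ?imset_f.
  apply/connP => _ _ /imsetP[a aD ->] /imsetP[b bD ->].
  have /connectP[s] := cD a b aD bD; elim: s a aD => [|c s IH] a aD /=.
    by move=> _ ->.
  case/andP=> /and3P[_ cD' ac] cs eb; apply: connect_trans (IH c cD' cs eb).
  by apply: connect1; rewrite /= !imset_f // fA.
by rewrite imset_disjoint ?dD //; exact: in2W.
Qed.

Lemma cage_theta l : 2 < l -> exists x y (D : 'I_3 -> {set CAGE 3 l}), theta x y D.
Proof.
move=> l2; have m0 : 0 < l - 2 by lia.
exists (inl false : CAGE 3 l), (inl true : CAGE 3 l).
exists (fun i => [set (inr (i, j) : CAGE 3 l) | j : 'I_(l - 2)]).
split=> [//|i|i i' ii'].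
  split.
  - apply: (@conn_from _ _ (inr (i, Ordinal m0) : CAGE 3 l)) => _ /imsetP[[j jl] _ ->].
    elim: j jl => [|j IH] jl; first by rewrite (bool_irrelevance jl m0) connect0.
    apply: connect_trans (IH (ltnW jl)) _; apply: connect1.
    by rewrite /= !imset_f //= /cage_adj /= !eqxx.
  - by apply/imsetP => -[].
  - by apply/imsetP => -[].
  - by exists (inr (i, Ordinal m0)); rewrite ?imset_f.
  have ml : (l - 2).-1 < l - 2 by rewrite prednK.
  exists (inr (i, Ordinal ml) : CAGE 3 l); first exact: imset_f.
  by rewrite /= /cage_adj /= prednK.
rewrite disjoints_subset; apply/subsetP => _ /imsetP[j _ ->]; rewrite inE.
by apply/imsetP => -[j' _ [ei _]]; rewrite ei eqxx in ii'.
Qed.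

Lemma deg2_nbr (G : sgraph) (v p q r : G) : degree v = 2 ->
  adj v p -> adj v q -> adj v r -> p != q -> (r == p) || (r == q).
Proof.
move=> dv vp vq vr pq; apply/negPn/negP; rewrite negb_or => /andP[rp rq].
have : [set r; p; q] \subset [set w | adj v w].
  by apply/subsetP => w; rewrite !inE => /orP[/orP[]|] /eqP->.
by move/subset_leq_card; rewrite -/(degree v) dv -setUA cardsU1 cards2 !inE negb_or rp rq pq.
Qed.

Lemma deg2_other (G : sgraph) (v p : G) : degree v = 2 -> adj v p ->
  exists2 q, adj v q & q != p.
Proof.
rewrite /degree (cardsD1 p) inE => + vp; rewrite vp => -[/eqP/cards1P[q e]].
by have := set11 q; rewrite -e !inE => /andP[]; exists q.
Qed.

Lemma deg4_nbrs (G : sgraph) (a b : G) : degree a = 4 -> adj a b ->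
  exists s, [/\ size s = 3, uniq s, b \notin s & forall v, adj a v = (v \in b :: s)].
Proof.
move=> da ab; pose N := [set w | adj a w].
exists (enum (N :\ b)); split.
- by rewrite -cardE; move: da; rewrite /degree (cardsD1 b) inE ab => -[].
- exact: enum_uniq.
- by rewrite mem_enum !inE eqxx.
by move=> v; rewrite inE mem_enum !inE; case: eqP => // ->.
Qed.

(* p lists the component of u in G - {a, b}. *)
Definition arm (G : sgraph) (a b u : G) (p : seq G) : Prop :=
  [/\ uniq p, sorted (@adj G) p, u \in p, (a \notin p) && (b \notin p) &
      forall v w, v \in p -> adj v w -> w \in [:: a, b & p]].

(** The list [q] can be left only through its two ends, which [p] avoids; as [p] is connected, it
    stays in [q] once it meets it. Equality of the end pairs as sets allows arms built from either
    end to be compared. *)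
Lemma arm_meet (G : sgraph) (a b u a' b' u' v : G) (p q : seq G) :
  arm a b u p -> arm a' b' u' q -> [set a; b] = [set a'; b'] ->
  v \in p -> v \in q -> u \in q.
Proof.
move=> [_ sp up /andP[ap bp] _] [_ _ _ _ Hq] e vp vq; apply/negPn/negP => uq.
have [||||w [z [wS zp zS wz]]] :=
  @conn_boundary G [set x in p] [set x in p | x \in q] v u (conn_sorted sp).
- by apply/subsetP => x; rewrite !inE => /andP[].
- by rewrite inE vp.
- by rewrite inE.
- by rewrite inE up.
move: wS zp zS; rewrite !inE => /andP[wp wq] zp; rewrite zp /= => zq.
have := Hq w z wq wz; rewrite !inE (negPf zq) orbF => zab.
have : z \in [set a; b] by rewrite e !inE.
by rewrite !inE => /orP[] /eqP ez; [move: ap|move: bp]; rewrite -ez zp.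
Qed.

(* A longest path p from u avoiding a and b: all inner vertices have degree 2, so
   the second neighbour of its last vertex can only be b (first case) or a. *)
Lemma arm_exists k (G : sgraph) (a b u : G) : all_icycles k G -> adj a b ->
  (forall v, v != a -> v != b -> degree v = 2) -> adj a u -> u != b ->
  exists p, arm a b u p /\
    ((size p + 2 = k /\ exists l, [/\ l \in p, {in p, forall v, adj a v = (v == u)} &
        {in p, forall v, adj b v = (v == l)}])
  \/ (size p + 1 = k /\ exists l, [/\ l \in p, l != u,
        {in p, forall v, adj a v = (v == u) || (v == l)} &
        {in p, forall v, ~~ adj b v}])).
Proof.
move=> Hk ab deg au ub; have ua : u != a by apply: contraTneq au => ->; rewrite adj_irr.
pose ok (s : seq G) := [&& path (@adj G) u s, uniq (u :: s), a \notin u :: s & b \notin u :: s].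
have ok0 : ok [::] by rewrite /ok /= !inE ![_ == u]eq_sym ua ub.
have [s oks smax] : exists2 s, ok s & forall t, ok t -> size t <= size s.
  have ex : exists n, [exists t : n.-tuple G, ok t].
    by exists 0; apply/existsP; exists [tuple].
  have ub' n : [exists t : n.-tuple G, ok t] -> n <= #|G|.
    case/existsP => t /and4P[_ /= /andP[_ Ut] _ _].
    by rewrite -(size_tuple t) -(card_uniqP Ut) max_card.
  case: (ex_maxnP ex ub') => m /existsP[s oks] mmax; exists s => // t okt.
  by rewrite size_tuple; apply: mmax; apply/existsP; exists (in_tuple t).
have /and4P[us Us as_ bs] := oks.
pose p := u :: s; pose q := a :: p.
have Uq : uniq q by rewrite /q cons_uniq as_.
have qE t : nth a q t.+1 = nth a p t by [].
have qadj t : t < size p -> adj (nth a q t.+1) (nth a q t).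
  have : path (@adj G) a p by rewrite /= au.
  by move/(pathP a) => H tp; rewrite adj_sym qE; apply: H.
have pdeg t : t < size p -> degree (nth a p t) = 2.
  move=> tp; have pt : nth a p t \in p by rewrite mem_nth.
  by apply: deg; apply: contraTneq pt => ->.
have lp : size s < size p by [].
have [w lw wprev] := deg2_other (pdeg _ lp) (qadj _ lp).
(* Otherwise [w] would have three neighbours: its two on [q] and the last vertex of [p]. *)
have wp : w \notin p.
  apply/negP => /(nthP a)[t tp ew]; move: lw wprev; rewrite -ew => lw wprev.
  have ts : t != size s by apply: contraTneq lw => ->; rewrite adj_irr.
  have tlt : t.+1 < size p by rewrite ltn_neqAle eqSS ts.
  have h1 : adj (nth a p t) (nth a q t.+2) by rewrite -qE adj_sym; exact: (qadj t.+1).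
  have h2 : adj (nth a p t) (nth a p (size s)) by rewrite adj_sym.
  have tq : t < size q by rewrite ltnW.
  have ne : nth a q t != nth a q t.+2.
    by rewrite nth_uniq // -[t.+2]addn2 -[X in X == _]addn0 eqn_add2l.
  have := deg2_nbr (pdeg _ tp) (qadj _ tp) h1 h2 ne.
  rewrite -[nth a p (size s)]qE !nth_uniq // => /orP[/eqP e|].
    by rewrite -e ltnn in tp.
  move: wprev; rewrite -qE nth_uniq // eqSS => /negPf; by rewrite eq_sym => ->.
have wab : (w == a) || (w == b).
  apply/negPn/negP; rewrite negb_or => /andP[wa wb].
  have /smax : ok (rcons s w).
    apply/and4P; split.
    - by rewrite rcons_path us -(nth_last a (u :: s) : _ = last u s).
    - by rewrite -rcons_cons rcons_uniq wp.
    - by rewrite -rcons_cons mem_rcons inE negb_or eq_sym wa.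
    by rewrite -rcons_cons mem_rcons inE negb_or eq_sym wb.
  by rewrite size_rcons ltnn.
(* The list [r] runs from [a] through [p] to [w]: the vertex [p_t] sits at position [t + 1], and its
   neighbours are at [t] and [t + 2]. *)
pose r := rcons q w.
have rE t : t <= size p -> nth a r t = nth a q t.
  by move=> tp; rewrite /r nth_rcons ifT.
have rw : nth a r (size p).+1 = w by rewrite /r nth_rcons ltnn eqxx.
have radj t : t < size p -> adj (nth a p t) (nth a r t.+2).
  move=> tp; have [lt|ge] := ltnP t.+1 (size p).
    by rewrite rE // -qE adj_sym qadj.
  have -> : t = size s by apply/eqP; rewrite eqn_leq -ltnS tp -ltnS ge.
  by rewrite rw.
have rne t : t < size p -> nth a r t != nth a r t.+2.
  move=> tp; rewrite rE ?(ltnW tp) //; have [lt|ge] := ltnP t.+1 (size p).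
    by rewrite rE // nth_uniq //; [clear; lia|exact: ltnW].
  have -> : t = size s by apply/eqP; rewrite eqn_leq -ltnS tp -ltnS ge.
  by rewrite rw eq_sym.
have nbr t v : t < size p -> adj (nth a p t) v = (v == nth a r t) || (v == nth a r t.+2).
  move=> tp; apply/idP/idP => [tv|/orP[] /eqP->]; last exact: radj.
    apply: deg2_nbr tv _ => //; [exact: pdeg| |exact: radj|exact: rne].
    by rewrite rE ?(ltnW tp) // qadj.
  by rewrite rE ?(ltnW tp) // qadj.
have Hp : ipath p.
  split=> // x0 i j /andP[ij jp]; rewrite !(set_nth_default a x0) //; last exact: ltn_trans jp.
  rewrite nbr; last exact: ltn_trans jp.
  have ip : i.+1 < size p by exact: leq_ltn_trans jp.
  rewrite !rE; [|exact: ip|exact: ltnW (ltnW ip)].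
  rewrite -[nth a p j]qE !nth_uniq //; try exact: ltnW; try exact: ltnW (ltnW ip).
  by clear -ij; lia.
have pa t : t < size p -> adj (nth a p t) a = (t == 0) || (t == size s) && (w == a).
  move=> tp; rewrite nbr // rE ?(ltnW tp) //.
  rewrite -[X in X == _]/(nth a q 0) nth_uniq //; last exact: ltnW.
  rewrite [0 == t]eq_sym; congr (_ || _).
  have [lt|ge] := ltnP t.+1 (size p).
    rewrite rE // -[X in X == _]/(nth a q 0) nth_uniq //=.
    by rewrite (ltn_eqF (lt : t < size s)).
  have -> : t = size s by apply/eqP; rewrite eqn_leq -ltnS tp -ltnS ge.
  by rewrite rw eqxx eq_sym.
have pb t : t < size p -> adj (nth a p t) b = (t == size s) && (w == b).
  have bq i : i <= size p -> (b == nth a q i) = false.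
    move=> iq; apply/negbTE; have : nth a q i \in q by rewrite mem_nth.
    apply: contraTneq => <-; rewrite inE negb_or bs andbT.
    by apply: contraTneq ab => ->; rewrite adj_irr.
  move=> tp; rewrite nbr // rE ?(ltnW tp) // bq ?(ltnW tp) // orFb.
  have [lt|ge] := ltnP t.+1 (size p); first by rewrite rE // bq // (ltn_eqF (lt : t < size s)).
  have -> : t = size s by apply/eqP; rewrite eqn_leq -ltnS tp -ltnS ge.
  by rewrite rw eqxx eq_sym.
have subp v : v \in p -> v \in [:: a, b & p].
  by move=> vp; rewrite in_cons in_cons vp !orbT.
have idx v : v \in p -> exists2 t, t < size p & v = nth a p t.
  by move=> /(nthP a)[t tp e]; exists t.
exists p; split.
  split=> //; first by rewrite inE eqxx.
    by rewrite as_.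
  move=> v z /idx[t tp ->]; rewrite nbr // => /orP[] /eqP->.
    rewrite rE ?(ltnW tp) //; case: t tp => [|t] tp; first by rewrite inE eqxx.
    by rewrite qE subp // mem_nth // ltnW.
  have [lt|ge] := ltnP t.+1 (size p); first by rewrite rE // qE subp // mem_nth.
  have -> : t = size s by apply/eqP; rewrite eqn_leq -ltnS tp -ltnS ge.
  by rewrite rw; case/orP: wab => /eqP->; rewrite !inE eqxx ?orbT.
have lpin : nth a p (size s) \in p by rewrite mem_nth.
have nab : a != b by apply: contraTneq ab => ->; rewrite adj_irr.
have uE : u = nth a p 0 by [].
case/orP: wab => /eqP ew; [right|left].
  (* If [p] were the single vertex [u], its predecessor on [q] would be [a], from which [w]
     differs. *)
  have s0 : 0 < size s.
    by rewrite lt0n; apply: contra wprev => /eqP->; rewrite ew.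
  split.
    suff /Hk : icycle ([:: a] ++ p) by rewrite size_cat addnC.
    apply: icycle_cat => //; first exact: ipath1.
    move=> x0 [|//] t _ tp; rewrite [LHS]adj_sym (set_nth_default a) //.
    by rewrite pa // ew eqxx andbT.
  exists (nth a p (size s)); split=> //.
  - by rewrite uE nth_uniq // -lt0n.
  - move=> v /idx[t tp ->]; rewrite adj_sym pa // ew eqxx andbT uE.
    by rewrite !nth_uniq.
  by move=> v /idx[t tp ->]; rewrite adj_sym pb // ew (negPf nab) andbF.
have nba : (b == a) = false by rewrite eq_sym (negPf nab).
split.
  suff /Hk : icycle ([:: b; a] ++ p) by rewrite size_cat addnC.
  apply: icycle_cat => //.
  - apply: ipath_cons; [exact: ipath1|by rewrite inE eq_sym|].
    by move=> x0 [|t] //= _; rewrite adj_sym.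
  - rewrite cat_uniq Us andbT; apply/andP; split; first by rewrite /= inE nba.
    apply/hasPn => v vp; rewrite !inE negb_or.
    by apply/andP; split; apply: contraTneq vp => ->.
  move=> x0 [|[|//]] t _ tp; rewrite [LHS]adj_sym (set_nth_default a) //.
    by rewrite pb // ew eqxx andbT.
  by rewrite pa // ew nba andbF orbF.
exists (nth a p (size s)); split=> //.
  by move=> v /idx[t tp ->]; rewrite adj_sym pa // ew nba andbF orbF uE nth_uniq.
by move=> v /idx[t tp ->]; rewrite adj_sym pb // ew eqxx andbT nth_uniq.
Qed.

(** The arms started by the three neighbours of [a] other than [b] are the legs, once each is known
    to reach [b]; an arm returning to [a] would force more vertices than a pyramid has. *)
Lemma pyramid_theta k (P : sgraph) : is_3_Ck_pyramid k P -> 4 < k ->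
  exists a b (D : 'I_3 -> {set P}), theta a b D.
Proof.
case=> /SC_icycles Hk card _ [a [b [ab da db deg]]] k4.
have ba : adj b a by rewrite adj_sym.
have nab : a != b by apply: contraTneq ab => ->; rewrite adj_irr.
have [s [s3 Us bs Hs]] := deg4_nbrs da ab.
have [s' [s'3 Us' as' Hs']] := deg4_nbrs db ba.
have nbr u : u \in s -> adj a u /\ u != b.
  by move=> us; rewrite Hs inE us orbT; split=> //; apply: contraNneq bs => <-.
have key u : u \in s -> exists p, arm a b u p /\ exists l, [/\ l \in p,
    {in p, forall v, adj a v = (v == u)} & {in p, forall v, adj b v = (v == l)}].
  move=> us; have [au ub] := nbr u us.
  have [p [Ap [[_ Hl]|[sp [l [lp lu Hl nb]]]]]] := arm_exists Hk ab deg au ub.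
    by exists p.
  (* The arm at [u] returns to [a] and uses up two of the three neighbours; the third, [w], starts
     an arm that has to reach [b], as returning would need a fourth neighbour. *)
  exfalso; have [Up _ up /andP[ap bp] _] := Ap.
  have ins v : v \in p -> adj a v -> v \in s.
    by move=> vp; rewrite Hs inE => /predU1P[e|//]; rewrite -e vp in bp.
  have ls : l \in s by rewrite ins // Hl // eqxx orbT.
  have [w ws] : exists2 w, w \in s & w \notin [:: u; l] by apply: exists_notin; rewrite ?s3.
  rewrite !inE negb_or => /andP[wu wl].
  have [aw wb] := nbr w ws.
  have wp : w \notin p by apply: contraL aw => /Hl->; rewrite (negPf wu).
  have [q [Aq q_cases]] := arm_exists Hk ab deg aw wb.
  have dpq v : v \in p -> v \notin q.
    by move=> vp; apply: contra wp => vq; exact: arm_meet Aq Ap erefl vq vp.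
  have [Uq _ wq /andP[aq bq] _] := Aq.
  case: q_cases => [[sq [l' [l'q _ Hl']]]|[_ [l' [l'q l'w Hl' _]]]]; last first.
    have l's : l' \in s.
      have : adj a l' by rewrite Hl' // eqxx orbT.
      by rewrite Hs inE => /predU1P[e|//]; rewrite -e l'q in bq.
    have l'u : l' != u by apply: contraTneq l'q => ->; exact: dpq.
    have l'l : l' != l by apply: contraTneq l'q => ->; exact: dpq.
    have U4 : uniq [:: u; l; w; l'].
      rewrite /= !inE !negb_or ![u == _]eq_sym lu wu l'u.
      by rewrite ![l == _]eq_sym wl l'l eq_sym l'w.
    have : {subset [:: u; l; w; l'] <= s}.
      by move=> v; rewrite !inE => /or4P[] /eqP->.
    by move/(uniq_leq_size U4); rewrite s3.
  have [v vs' vl'] : exists2 v, v \in s' & v \notin [:: l'].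
    by apply: exists_notin; rewrite ?s'3.
  have bv : adj b v by rewrite Hs' inE vs' orbT.
  have va : v != a by apply: contraNneq as' => <-.
  (* A third arm, started from [b] with [a] and [b] exchanged and disjoint from the other two.
     Together this makes at least [2 + (k - 1) + (k - 2) + (k - 2)] vertices, more than
     [3 * (k - 2) + 2]. *)
  have [r [Ar r_cases]] := arm_exists Hk ba (fun v vb va => deg v va vb) bv va.
  have sr : k <= size r + 2 by case: r_cases => -[e _]; clear -e; lia.
  have eab : [set b; a] = [set a; b] by rewrite setUC.
  have vp : v \notin p by apply: contraL bv => /nb.
  have vq : v \notin q by apply: contraL bv => /Hl'->; move: vl'; rewrite inE.
  have [Ur _ _ /andP[br ar] _] := Ar.
  have Uall : uniq (a :: b :: p ++ q ++ r).
    rewrite /= !inE !mem_cat !negb_or nab ap aq ar bp bq br !cat_uniq Up Uq Ur !andbT /=.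
    rewrite has_cat negb_or; apply/andP; split; first (apply/andP; split).
    - by apply/hasPn => z zq; apply: contraL zq => /dpq.
    - by apply/hasPn => z zr; apply: contra vp => zp; exact: arm_meet Ar Ap eab zr zp.
    by apply/hasPn => z zr; apply: contra vq => zq; exact: arm_meet Ar Aq eab zr zq.
  have : size (a :: b :: p ++ q ++ r) <= #|P| by rewrite -(card_uniqP Uall) max_card.
  by rewrite card /= !size_cat; clear -sp sq sr k4; lia.
have us (i : 'I_3) : nth a s i \in s by rewrite mem_nth // s3.
have [p Hp] := @fin_all_exists _ (fun=> seq P)
  (fun (i : 'I_3) q => arm a b (nth a s i) q /\ exists l, [/\ l \in q,
    {in q, forall v, adj a v = (v == nth a s i)} & {in q, forall v, adj b v = (v == l)}])
  (fun i => key _ (us i)).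
exists a, b, (fun i => [set v in p i]); split=> // [i|i j ij].
  have [[_ sp up /andP[ap bp] _] [l [lp _ Hl]]] := Hp i.
  split; rewrite ?inE //; first exact: conn_sorted.
  - by exists (nth a s i); rewrite ?inE // (nbr _ (us i)).1.
  by exists l; rewrite ?inE // Hl // eqxx.
rewrite disjoints_subset; apply/subsetP => v; rewrite !inE => vi; apply/negP => vj.
have [Ai _] := Hp i; have [Aj [l [_ Hl _]]] := Hp j.
(* If two arms met, the start of one would lie on the other, where [a] has only one neighbour. *)
have := Hl _ (arm_meet Ai Aj erefl vi vj).
rewrite (nbr _ (us i)).1 nth_uniq ?s3 // => /esym.
by rewrite val_eqE (negPf ij).
Qed.

(** Since [k./2] rounds down, the guard [~~ odd k] restricts the cage condition to those [k] for
    which [k/2 + 1] is an integer. *)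
Theorem theorem7 (k : nat) (hk : 5 <= k) (G : sgraph) (hG : is_SC k G) :
  hamiltonian G <->
  [/\ kconnected 2 G,
      ~~ odd k -> ~ contains_induced G (CAGE 3 (k./2 + 1)) &
      forall P : sgraph, is_3_Ck_pyramid k P -> ~ contains_induced G P].
Proof.
have Hk := SC_icycles hG.
split=> [ham|[G2 nocage nopyr]]; last exact: hamiltonian_if hG hk G2 nocage nopyr.
split.
- by apply: hamiltonian_kconn2 ham; case: hG.
- move=> _ [f [fI fA]]; have l2 : 2 < k./2 + 1 by lia.
  have [x [y [D T]]] := cage_theta l2.
  exact: hamiltonian_no_theta Hk hk ham (theta_embed fI fA T).
move=> P HP [f [fI fA]]; have [x [y [D T]]] := pyramid_theta HP hk.
exact: hamiltonian_no_theta Hk hk ham (theta_embed fI fA T).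
Qed.
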